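(* The distribution $\mathcal L\to\mathfrak D^{(m)}_{\mathrm{KZ}}$ is invariant with respect to the KZ connection. In other words, if $s(z)$ is a local section of $\mathcal L\to\mathfrak D^{(m)}_{\mathrm{KZ}}$, then the sections $\nabla_i^{\mathrm{KZ}}s(z)$, $i=1,\dots,n$ (considered where the connection is defined, i.e. away from the diagonal hyperplanes $z_i=z_j$, $i\ne j$), also are sections of $\mathcal L\to\mathfrak D^{(m)}_{\mathrm{KZ}}$.
   Context: Let $g\ge1$, $n=2g+1$, and let $p$ be a prime with $p>2g+1$; $z=(z_1,\dots,z_n)$. For $s\ge1$ let $\Phi_s(t,z)=\big((t-z_1)\cdots(t-z_n)\big)^{(p^s-1)/2}$, $F(t,z)=\Phi_1(t,z)$. Hasse–Witt matrices: $A(s,\Phi_s(t,z))$ is the $g\times g$ matrix whose $(u,v)$ entry ($u,v=1,\dots,g$) is the coefficient of $t^{p^sv-u}$ in $\Phi_s(t,z)$; its entries are in $\mathbb Z[z]$. For $\ell=1,\dots,g$, let $I_{s,\ell}(z)=(I_{s,\ell,1},\dots,I_{s,\ell,n})$ be the column $n$-vector which is the coefficient of $t^{\ell p^s-1}$ in the column $n$-vector $\Big(\frac{\Phi_s(t,z)}{t-z_1},\dots,\frac{\Phi_s(t,z)}{t-z_n}\Big)$ of polynomials; $I_s(z)$ is the $n\times g$ matrix with columns $I_{s,1},\dots,I_{s,g}$. $\mathbb Q_p^{(m)}$ is the unramified extension of $\mathbb Q_p$ of degree $m$, with ring of integers $\mathbb Z_p^{(m)}$ and norm $|\cdot|_p$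 extending that of $\mathbb Q_p$. Let $d=\frac{p-1}2g^2$ and assume $p^m>d$. Put $\mathfrak D^{(m)}_{\mathrm{KZ}}=\{a\in(\mathbb Z_p^{(m)})^n : |\det A(1,F(t,a))|_p=1\}$ (nonempty under this assumption). It is a fact that the $n\times g$ matrices $I_s(z)\cdot A(s,\Phi_s(t,z))^{-1}$, whose entries are rational functions regular on $\mathfrak D^{(m)}_{\mathrm{KZ}}$, converge uniformly on $\mathfrak D^{(m)}_{\mathrm{KZ}}$ as $s\to\infty$ to an analytic $n\times g$ matrix, denoted $\mathcal I(z)$. Let $W=\{(I_1,\dots,I_n)\in(\mathbb Q_p^{(m)})^n : I_1+\dots+I_n=0\}$ (column vectors). For $a\in\mathfrak D^{(m)}_{\mathrm{KZ}}$ let $\mathcal L_a\subset W$ be the subspace spanned by the columns of $\mathcal I(a)$, and let $\mathcal L=\bigcup_{a}\mathcal L_a\to\mathfrak D^{(m)}_{\mathrm{KZ}}$, a distribution of subspaces in the fibers of the trivial bundle $W\times\mathfrak D^{(m)}_{\mathrm{KZ}}\to\mathfrak D^{(m)}_{\mathrm{KZ}}$. A local section of $\mathcal L$ is a function of the form $s(z)=\sum_{j=1}^gc_j(z)\mathcal I_j(z)$ where $\mathcal I_1,\dots,\mathcal I_g$ are the columns of $\mathcal I$ and the $c_j$ are analytic functions near a point. KZ connection: $\nabla_i^{\mathrm{KZ}}=\frac{\partial}{\partial z_i}-H_i(z)$, $i=1,\dots,n$, where $H_i(z)=\frac12\sum_{j\ne i}\frac{\Omega_{ij}}{z_i-z_j}$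 and $\Omega_{ij}$ is the $n\times n$ matrix with $(i,i)$ and $(j,j)$ entries $-1$, $(i,j)$ and $(j,i)$ entries $1$, and all other entries $0$. It has singularities at the diagonal hyperplanes $z_i=z_j$. *)

(* Defs.v *)
From HB Require Import structures.
From mathcomp Require Import all_boot all_order all_algebra all_field.
From mathcomp Require Import classical_sets reals.
Set Implicit Arguments.
Unset Strict Implicit.
Unset Printing Implicit Defensive.
Import Order.TTheory GRing.Theory Num.Theory.
Local Open Scope classical_set_scope.
Local Open Scope ring_scope.

Section AbsoluteValue.
Variables (R : realType) (K : fieldType) (abs : K -> R).

Definition nonarch_abs : Prop :=
  [/\ forall x, 0 <= abs x,
      forall x, abs x = 0 <-> x = 0,
      forall x y, abs (x * y) = abs x * abs y
    & forall x y, abs (x + y) <= Num.max (abs x) (abs y)].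

Definition abs_cvg (u : nat -> K) (l : K) : Prop :=
  forall e : R, 0 < e -> exists N, forall k, (N <= k)%N -> abs (u k - l) < e.

Definition abs_cauchy (u : nat -> K) : Prop :=
  forall e : R, 0 < e ->
    exists N, forall j k, (N <= j)%N -> (N <= k)%N -> abs (u j - u k) < e.

Definition abs_complete : Prop :=
  forall u, abs_cauchy u -> exists l, abs_cvg u l.

End AbsoluteValue.

Definition padic_norm (R : realType) (p : nat) (q : rat) : R :=
  if q == 0 then 0
  else p%:R ^+ logn p `|denq q| / p%:R ^+ logn p `|numq q|.

(** Q_p is pinned down as the completion of the rationals for the p-adic norm:
    this determines the normed field up to a unique isometric isomorphism. *)
Definition is_Qp (R : realType) (p : nat) (Qp : fieldType) (abs : Qp -> R) :
    Prop :=
  [/\ nonarch_abs abs,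
      forall q : rat, abs (ratr q) = padic_norm R p q,
      forall (x : Qp) (e : R), 0 < e -> exists q : rat, abs (x - ratr q) < e
    & abs_complete abs].

(** Since the residue field of Q_p is finite, hence perfect, an extension is
    unramified as soon as its ramification index is 1, i.e., as soon as the
    value group does not grow. *)
Definition is_unramified_ext (R : realType) (Qp : fieldType) (absQp : Qp -> R)
    (m : nat) (K : fieldExtType Qp) (abs : K -> R) : Prop :=
  [/\ \dim {:K} = m,
      nonarch_abs abs,
      forall x : Qp, abs x%:A = absQp x
    & forall y : K, exists x : Qp, abs y = absQp x].

Section Analysis.
Variables (R : realType) (K : fieldType) (abs : K -> R) (n : nat).
Implicit Types (f : 'rV[K]_n -> K) (U : set 'rV[K]_n) (z b : 'rV[K]_n).

Definition open_set U : Prop :=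
  forall b, U b -> exists2 r : R, 0 < r &
    forall z, (forall i, abs (z 0 i - b 0 i) < r) -> U z.

Definition multi_index := {ffun 'I_n -> nat}.

Definition mi_degree (al : multi_index) : nat := \sum_i al i.

(** Sum of the terms whose exponents are all smaller than [N]. *)
Definition power_series_sum (a : multi_index -> K) b z (N : nat) : K :=
  \sum_(al : {ffun 'I_n -> 'I_N})
     a [ffun i => al i : nat] * \prod_i (z 0 i - b 0 i) ^+ al i.

Definition analytic_at f b : Prop :=
  exists (a : multi_index -> K) (r : R),
  [/\ 0 < r,
      forall e : R, 0 < e -> exists N, forall al : multi_index,
        (N <= mi_degree al)%N -> abs (a al) * r ^+ mi_degree al < e
    & forall z, (forall i, abs (z 0 i - b 0 i) <= r) ->
        abs_cvg abs (power_series_sum a b z) (f z)].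

Definition analytic_on f U : Prop := forall b, U b -> analytic_at f b.

Definition is_partial (i : 'I_n) f z (l : K) : Prop :=
  forall e : R, 0 < e -> exists2 del : R, 0 < del &
    forall h : K, h != 0 -> abs h < del ->
      abs ((f (z + h *: delta_mx 0 i) - f z) / h - l) < e.

End Analysis.

(** Points z are row vectors, elements of the fiber are column vectors.
    All polynomials in z are represented by their values at points of K^n.
    The indices u, v, l = 1, ..., g are shifted to 0, ..., g - 1. *)

Section KZ.
Variables (R : realType) (K : fieldType) (abs : K -> R) (p g : nat).
Local Notation n := (2 * g + 1)%N.
Implicit Types (z : 'rV[K]_n) (s : nat).

Definition Phi s z : {poly K} :=
  (\prod_(i < n) ('X - (z 0 i)%:P)) ^+ ((p ^ s - 1) %/ 2)%N.

Definition hasse_witt s z : 'M[K]_g :=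
  \matrix_(u < g, v < g) (Phi s z)`_(p ^ s * v.+1 - u.+1)%N.

(** The polynomial division by t - z_i is exact when p is odd and s >= 1. *)
Definition hypergeom s z : 'M[K]_(n, g) :=
  \matrix_(i < n, l < g) (Phi s z %/ ('X - (z 0 i)%:P))`_(l.+1 * p ^ s - 1)%N.

Definition D_KZ : set 'rV[K]_n :=
  [set a : 'rV[K]_n | (forall i, abs (a 0 i) <= 1) /\ abs (\det (hasse_witt 1 a)) = 1].

Definition is_limit_matrix (Ical : 'rV[K]_n -> 'M[K]_(n, g)) : Prop :=
  forall e : R, 0 < e -> exists N, forall s, (N <= s)%N ->
    forall a, D_KZ a -> forall i l,
      abs ((hypergeom s a *m invmx (hasse_witt s a)) i l - Ical a i l) < e.

Definition is_section (Ical : 'rV[K]_n -> 'M[K]_(n, g)) (U : set 'rV[K]_n)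
    (f : 'rV[K]_n -> 'cV[K]_n) : Prop :=
  exists2 c : 'I_g -> 'rV[K]_n -> K,
    forall j, analytic_on abs (c j) U &
    forall z, U z -> f z = \sum_j c j z *: col j (Ical z).

Definition Omega (i j : 'I_n) : 'M[K]_n :=
  delta_mx i j + delta_mx j i - delta_mx i i - delta_mx j j.

Definition KZ_H (i : 'I_n) z : 'M[K]_n :=
  2%:R^-1 *: \sum_(j < n | j != i) (z 0 i - z 0 j)^-1 *: Omega i j.

(** [w] is the value at [z] of (d/dz_i - H_i) f; in particular the partial
    derivative of [f] exists at [z]. *)
Definition is_nabla_KZ (i : 'I_n) (f : 'rV[K]_n -> 'cV[K]_n) z (w : 'cV[K]_n) :
    Prop :=
  exists2 df : 'cV[K]_n,
    forall k, is_partial abs i (fun x => f x k 0) z (df k 0) &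
    w = df - KZ_H i z *m f z.

Definition off_diagonals : set 'rV[K]_n :=
  [set z : 'rV[K]_n | forall i j : 'I_n, i != j -> z 0 i != z 0 j].

End KZ.

(* Main.v *)
Require Import Defs.
From HB Require Import structures.
From mathcomp Require Import all_boot all_order all_algebra all_field.
From mathcomp Require Import classical_sets reals.
From mathcomp Require Import perm boolp mpoly ring lra zify.
Set Implicit Arguments.
Unset Strict Implicit.
Unset Printing Implicit Defensive.
Import Order.TTheory GRing.Theory Num.Theory.
Local Open Scope classical_set_scope.
Local Open Scope ring_scope.

(** The matrices [J_s := I_s A_s^-1] converge pointwise on [D_KZ], so their limit
    is analytic: around a point [b] of [D_KZ] the polynomials [I_s], [A_s] have
    integral coefficients and [det A_s] is a unit at [b], so that [J_s] is
    approximated on the polydisc of radius 1/2 by polynomials of Gauss norm at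
    most 1. For such polynomials pointwise convergence propagates to all the
    partial derivatives, hence to the Taylor coefficients.

    The columns of [I_s] solve the KZ equations modulo [p^s], so the covariant
    derivative of [J_s] is [J_s X_s] up to [O(p^s)], with [X_s] bounded but with
    no limit known beforehand. Let [V] be the [g x n] matrix of the powers
    [z_j^k], [k = 1, ..., g]. Comparing [t^k - z_j^k] with [t - z_j] gives
    [V I_s = T A_s + O(p^s)] for a triangular matrix [T] of power sums with
    constant nonzero determinant. Hence [J_s T^-1 V] is, up to [O(p^s)], a
    projector onto the column space of [J_s], and in the limit
    [nabla Ical = Ical (T^-1 V nabla Ical)], where the matrix in parentheses
    is analytic. *)

(** * Non-archimedean absolute values and limits *)

(** The arithmetic rests on two facts. With [e = (p^s - 1)/2] one has [2e + 1 = p^s], so [e] acts as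
    [-1/2] modulo [p^s]: this turns the exponent of [Phi] into the factor [1/2] of the KZ operators.
    And a derivative in [t] has coefficients divisible by [p^s] at the exponents [l p^s - 1], which
    is why these exponents are singled out. That [det A_s] is a unit comes from Frobenius: modulo
    the maximal ideal, [A_(s+1)] is [A_s] times the matrix of [p^s]-th powers of the entries of
    [A_1]. The obstacle is [X_s = A_s d(A_s^-1)], whose convergence would need separate congruences.
    Since [T] and [V] do not depend on [s], the relation [V Ical = T] holds in the limit, so
    [T^-1 V] is a left inverse of [Ical]; it recovers the coefficients of any vector of the span as
    explicit functions of [z]. The diagonal of [T] consists of the numbers [2k - n],
    [k = 1, ..., g], nonzero because [n = 2g + 1]. *)

Definition eventually (Q : nat -> Prop) : Prop :=
  exists N, forall k, (N <= k)%N -> Q k.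

Lemma eventuallyW (Q Q' : nat -> Prop) :
  (forall k, Q k -> Q' k) -> eventually Q -> eventually Q'.
Proof. by move=> QQ' [N hN]; exists N => k /hN /QQ'. Qed.

Lemma eventually_and (Q Q' : nat -> Prop) :
  eventually Q -> eventually Q' -> eventually (fun k => Q k /\ Q' k).
Proof.
move=> [N hN] [N' hN']; exists (maxn N N') => k; rewrite geq_max => /andP[h h'].
by split; [apply: hN | apply: hN'].
Qed.

Lemma eventually_forall (I : finType) (Q : I -> nat -> Prop) :
  (forall i, eventually (Q i)) -> eventually (fun k => forall i, Q i k).
Proof.
move=> hQ; have [N hN] := choice hQ.
exists (\max_i N i) => k hk i; apply: hN; apply: leq_trans hk.
exact: leq_bigmax.
Qed.

Section Norm.
Variables (R : realType) (K : fieldType) (abs : K -> R).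
Hypothesis habs : nonarch_abs abs.

Lemma abs_ge0 x : 0 <= abs x. Proof. by case: habs. Qed.

Lemma abs0 : abs 0 = 0. Proof. by case: habs => _ h _ _; apply/h. Qed.

Lemma abs_eq0 x : (abs x == 0) = (x == 0).
Proof. by case: habs => _ h _ _; apply/eqP/eqP => /h. Qed.

Lemma absM x y : abs (x * y) = abs x * abs y. Proof. by case: habs. Qed.

Lemma abs_gt0 x : (0 < abs x) = (x != 0).
Proof. by rewrite lt_def abs_ge0 andbT abs_eq0. Qed.

Lemma abs1 : abs 1 = 1.
Proof.
have h : abs 1 != 0 by rewrite abs_eq0 oner_eq0.
by apply: (mulfI h); rewrite -absM !mulr1.
Qed.

Lemma absN x : abs (- x) = abs x.
Proof.
have hN1 : abs (-1) = 1.
  have : abs (-1) ^+ 2 = 1 by rewrite expr2 -absM mulrNN mulr1 abs1.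
  move/eqP; rewrite sqrf_eq1 => /orP[/eqP //|/eqP h].
  by have := abs_ge0 (-1); rewrite h ler0N1.
by rewrite -mulN1r absM hN1 mul1r.
Qed.

Lemma abs_distC x y : abs (x - y) = abs (y - x).
Proof. by rewrite -absN opprB. Qed.

Lemma absX x k : abs (x ^+ k) = abs x ^+ k.
Proof. by elim: k => [|k IH]; rewrite ?expr0 ?abs1 // !exprS absM IH. Qed.

Lemma absV x : abs x^-1 = (abs x)^-1.
Proof.
have [->|x0] := eqVneq x 0; first by rewrite invr0 abs0 invr0.
have h : abs x != 0 by rewrite abs_eq0.
by apply: (mulfI h); rewrite -absM !divff // abs1.
Qed.

Lemma abs_max x y : abs (x + y) <= Num.max (abs x) (abs y).
Proof. by case: habs. Qed.

Lemma absD_le c x y : abs x <= c -> abs y <= c -> abs (x + y) <= c.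
Proof. by move=> hx hy; apply: le_trans (abs_max x y) _; rewrite ge_max hx. Qed.

Lemma absD_lt c x y : abs x < c -> abs y < c -> abs (x + y) < c.
Proof. by move=> hx hy; apply: le_lt_trans (abs_max x y) _; rewrite gt_max hx. Qed.

Lemma absB_le c x y : abs x <= c -> abs y <= c -> abs (x - y) <= c.
Proof. by move=> hx hy; apply: absD_le; rewrite ?absN. Qed.

Lemma abs_dist_lt c y x z : abs (x - y) < c -> abs (y - z) < c -> abs (x - z) < c.
Proof. by move=> h h'; rewrite -(subrK y x) -addrA; apply: absD_lt. Qed.

Lemma abs_sum_le (I : Type) (s : seq I) (P : pred I) (F : I -> K) c :
  0 <= c -> (forall i, P i -> abs (F i) <= c) -> abs (\sum_(i <- s | P i) F i) <= c.
Proof.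
move=> c0 h; elim/big_ind: _ => //; first by rewrite abs0.
by move=> x y; apply: absD_le.
Qed.

Lemma abs_prod (I : Type) (s : seq I) (P : pred I) (F : I -> K) :
  abs (\prod_(i <- s | P i) F i) = \prod_(i <- s | P i) abs (F i).
Proof. by rewrite (big_morph abs absM abs1). Qed.

Lemma abs_nat k : abs k%:R <= 1.
Proof.
elim: k => [|k IH]; first by rewrite abs0 ler01.
by rewrite -natr1; apply: absD_le; rewrite ?abs1.
Qed.

(** In an ultrametric triangle the two longest sides are equal. This makes the norm of a unit stable
    under small perturbations. *)
Lemma abs_eq_of_lt x y : abs (x - y) < abs y -> abs x = abs y.
Proof.
move=> h; apply/eqP; rewrite eq_le; apply/andP; split.
  by rewrite -(subrK y x); apply: absD_le => //; apply: ltW.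
rewrite leNgt; apply/negP => hlt.
have := absD_lt (c := abs y) (x := x) (y := y - x) hlt.
by rewrite abs_distC subrKC => /(_ h); rewrite ltxx.
Qed.

Lemma expr_eventually_lt (c e : R) : 0 <= c -> c < 1 -> 0 < e ->
  eventually (fun k => c ^+ k < e).
Proof.
move=> c0 c1 e0.
have [->|cn0] := eqVneq c 0; first by exists 1%N => -[|k] // _; rewrite expr0n.
have c_gt0 : 0 < c by rewrite lt_def cn0.
pose d := c^-1 - 1.
have d0 : 0 < d by rewrite subr_gt0 invf_gt1.
(* Bernoulli's inequality for [c^-1 = 1 + d]; the Archimedean property then makes [c^-1 ^+ k] exceed
   [e^-1]. *)
have bern k : 1 + k%:R * d <= c^-1 ^+ k.
  elim: k => [|k IH]; first by rewrite mul0r addr0 expr0.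
  have hd : c^-1 = 1 + d by rewrite /d; lra.
  rewrite exprS {1}hd.
  apply: le_trans (_ : (1 + d) * (1 + k%:R * d) <= _); last first.
    by rewrite ler_pM2l //; lra.
  by rewrite -natr1; have := ler0n R k; nra.
have [N hN] : exists N : nat, e^-1 / d < N%:R.
  by exists (Num.bound (e^-1 / d)); apply: archi_boundP; rewrite divr_ge0 ?invr_ge0 ?ltW.
exists N => k hk.
have hk' : e^-1 < c^-1 ^+ k.
  apply: lt_le_trans (bern k); move: hN; rewrite ltr_pdivrMr // => hN.
  apply: lt_le_trans hN _; apply: le_trans (_ : k%:R * d <= _); last by rewrite lerDr.
  by rewrite ler_pM2r // ler_nat.
by move: hk'; rewrite exprVn ltf_pV2 // posrE ?exprn_gt0.
Qed.

Lemma cvg_cst x : abs_cvg abs (fun=> x) x.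
Proof. by move=> e e0; exists 0%N => k _; rewrite subrr abs0. Qed.

Lemma cvg_eventually u v l : eventually (fun k => u k = v k) ->
  abs_cvg abs u l -> abs_cvg abs v l.
Proof.
move=> h hu e e0; apply: eventuallyW (eventually_and h (hu e e0)) => k [<-].
by [].
Qed.

Lemma cvgD u v l m : abs_cvg abs u l -> abs_cvg abs v m ->
  abs_cvg abs (fun k => u k + v k) (l + m).
Proof.
move=> hu hv e e0; apply: eventuallyW (eventually_and (hu e e0) (hv e e0)) => k [h h'].
by rewrite opprD addrACA; apply: absD_lt.
Qed.

Lemma cvgN u l : abs_cvg abs u l -> abs_cvg abs (fun k => - u k) (- l).
Proof. by move=> hu e e0; apply: eventuallyW (hu e e0) => k; rewrite -opprD absN. Qed.

Lemma cvgB u v l m : abs_cvg abs u l -> abs_cvg abs v m ->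
  abs_cvg abs (fun k => u k - v k) (l - m).
Proof. by move=> hu hv; apply: cvgD => //; apply: cvgN. Qed.

Lemma cvg_bounded u l : abs_cvg abs u l ->
  exists2 C, 0 < C & eventually (fun k => abs (u k) <= C).
Proof.
move=> hu; exists (abs l + 1); first by rewrite ltr_wpDl ?abs_ge0.
apply: eventuallyW (hu 1 ltr01) => k h; rewrite -(subrK l (u k)).
by apply: absD_le; have := abs_ge0 l; lra.
Qed.

Lemma cvg0_bounded u v C : eventually (fun k => abs (v k) <= C) ->
  abs_cvg abs u 0 -> abs_cvg abs (fun k => u k * v k) 0.
Proof.
move=> hv hu e e0.
have C'0 : 0 < `|C| + 1 by rewrite ltr_wpDl.
have e'0 : 0 < e / (`|C| + 1) by rewrite divr_gt0.
apply: eventuallyW (eventually_and (hu _ e'0) hv) => k []; rewrite !subr0 absM => h h'.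
apply: le_lt_trans (_ : abs (u k) * (`|C| + 1) < e); last by rewrite -ltr_pdivlMr.
apply: ler_wpM2l; first exact: abs_ge0.
by have := ler_norm C; lra.
Qed.

Lemma cvg_sub0 u l : abs_cvg abs (fun k => u k - l) 0 <-> abs_cvg abs u l.
Proof.
by split=> h e e0; apply: eventuallyW (h e e0) => k; rewrite ?subr0.
Qed.

Lemma cvgM u v l m : abs_cvg abs u l -> abs_cvg abs v m ->
  abs_cvg abs (fun k => u k * v k) (l * m).
Proof.
move=> hu hv; apply/cvg_sub0.
have [C _ hC] := cvg_bounded hu.
have h1 : abs_cvg abs (fun k => (v k - m) * u k) 0.
  by apply: cvg0_bounded hC _; apply/cvg_sub0.
have h2 : abs_cvg abs (fun k => (u k - l) * m) 0.
  by apply: (@cvg0_bounded _ _ (abs m)); [exists 0%N | apply/cvg_sub0].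
have := cvgD h1 h2; rewrite addr0; apply: cvg_eventually.
by exists 0%N => k _; ring.
Qed.

Lemma cvg_sum (I : Type) (s : seq I) (P : pred I) (u : I -> nat -> K) (l : I -> K) :
  (forall i, P i -> abs_cvg abs (u i) (l i)) ->
  abs_cvg abs (fun k => \sum_(i <- s | P i) u i k) (\sum_(i <- s | P i) l i).
Proof.
move=> h; elim: s => [|i s IH].
  by apply: cvg_eventually (cvg_cst _); exists 0%N => k _; rewrite !big_nil.
rewrite big_cons; case: ifP => Pi.
  apply: cvg_eventually (cvgD (h i Pi) IH).
  by exists 0%N => k _; rewrite big_cons Pi.
by apply: cvg_eventually IH; exists 0%N => k _; rewrite big_cons Pi.
Qed.

(** Were [abs l] larger than [C], it would be positive, and terms at distance less than [abs l] from
    [l] would have norm exactly [abs l]. *)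
Lemma cvg_le u l C : eventually (fun k => abs (u k) <= C) -> abs_cvg abs u l ->
  abs l <= C.
Proof.
move=> hC hu; rewrite leNgt; apply/negP => hlt.
have l0 : 0 < abs l.
  case: hC => N /(_ N (leqnn _)) h; exact: le_lt_trans (le_trans (abs_ge0 _) h) hlt.
have [N hN] := eventually_and hC (hu _ l0).
have [h1 h2] := hN N (leqnn _).
by have := abs_eq_of_lt h2; lra.
Qed.

Lemma cvg_unique u l m : abs_cvg abs u l -> abs_cvg abs u m -> l = m.
Proof.
move=> hl hm; apply/eqP; rewrite -subr_eq0 -abs_eq0 eq_le abs_ge0 andbT.
apply: cvg_le (cvgB hl hm); exists 0%N => k _.
by rewrite subrr abs0.
Qed.

Lemma cvg_cauchy u l : abs_cvg abs u l -> abs_cauchy abs u.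
Proof.
move=> hu e /hu[N hN]; exists N => j k /hN hj /hN hk.
by apply: (abs_dist_lt hj); rewrite abs_distC.
Qed.

Lemma cvg_expr x : abs x < 1 -> abs_cvg abs (fun k => x ^+ k) 0.
Proof.
move=> x1 e e0; apply: eventuallyW (expr_eventually_lt (abs_ge0 x) x1 e0) => k.
by rewrite subr0 absX.
Qed.

Lemma cvg_squeeze0 u (c : nat -> R) :
  (forall e, 0 < e -> eventually (fun k => c k < e)) ->
  eventually (fun k => abs (u k) <= c k) -> abs_cvg abs u 0.
Proof.
move=> hc hu e e0; apply: eventuallyW (eventually_and hu (hc e e0)) => k [h h'].
by rewrite subr0; apply: le_lt_trans h h'.
Qed.

(** * Limits and bounds of matrices *)

Definition mx_cvg m1 m2 (A : nat -> 'M[K]_(m1, m2)) (B : 'M[K]_(m1, m2)) : Prop :=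
  forall i j, abs_cvg abs (fun k => A k i j) (B i j).

Lemma mx_cvg_cst m1 m2 (A : 'M[K]_(m1, m2)) : mx_cvg (fun=> A) A.
Proof. by move=> i j; apply: cvg_cst. Qed.

Lemma mx_cvgM m1 m2 m3 A (B : 'M[K]_(m1, m2)) C (D : 'M[K]_(m2, m3)) :
  mx_cvg A B -> mx_cvg C D -> mx_cvg (fun k => A k *m C k) (B *m D).
Proof.
move=> hA hC i j; rewrite mxE.
apply: cvg_eventually (cvg_sum _ (fun x _ => cvgM (hA i x) (hC x j))).
by exists 0%N => k _; rewrite mxE.
Qed.

Lemma mx_cvgB m1 m2 A (B : 'M[K]_(m1, m2)) C D :
  mx_cvg A B -> mx_cvg C D -> mx_cvg (fun k => A k - C k) (B - D).
Proof.
move=> hA hC i j; rewrite !mxE.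
by apply: cvg_eventually (cvgB (hA i j) (hC i j)); exists 0%N => k _; rewrite !mxE.
Qed.

Lemma mx_cvg_unique m1 m2 A (B C : 'M[K]_(m1, m2)) :
  mx_cvg A B -> mx_cvg A C -> B = C.
Proof. by move=> hB hC; apply/matrixP => i j; apply: cvg_unique (hB i j) (hC i j). Qed.

Definition mx_bounded m1 m2 c (A : 'M[K]_(m1, m2)) : Prop :=
  forall i j, abs (A i j) <= c.

Lemma mx_boundedM m1 m2 m3 c d (A : 'M[K]_(m1, m2)) (B : 'M[K]_(m2, m3)) :
  0 <= c -> 0 <= d -> mx_bounded c A -> mx_bounded d B -> mx_bounded (c * d) (A *m B).
Proof.
move=> c0 d0 hA hB i j; rewrite mxE; apply: abs_sum_le => [|k _].
  exact: mulr_ge0.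
by rewrite absM ler_pM ?abs_ge0.
Qed.

Lemma mx_cvg0_scale m1 m2 (x : nat -> K) (A : nat -> 'M[K]_(m1, m2)) c :
  abs_cvg abs x 0 -> eventually (fun k => mx_bounded c (A k)) ->
  mx_cvg (fun k => x k *: A k) 0.
Proof.
move=> hx hA i j; rewrite mxE.
have h : eventually (fun k => abs (A k i j) <= c) by apply: eventuallyW hA => k; apply.
apply: cvg_eventually (cvg0_bounded h hx).
by exists 0%N => k _; rewrite mxE.
Qed.

End Norm.

(** * Gauss norms of polynomials *)

Section GaussNorm.
Variables (R : realType) (K : fieldType) (abs : K -> R) (n : nat).
Hypothesis habs : nonarch_abs abs.
Implicit Types (P Q : {mpoly K[n]}) (w : 'I_n -> K) (r C : R).

(** A bound on the Gauss norm of radius [r]. The form of an inequality lets a bound common to a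
    whole family be stated directly. *)
Definition gauss_le r C P : Prop := forall m, abs P@_m * r ^+ mdeg m <= C.

Lemma gauss_leW r C C' P : C <= C' -> gauss_le r C P -> gauss_le r C' P.
Proof. by move=> h hP m; apply: le_trans h. Qed.

Lemma gauss_le_radius r r' C P : 0 <= r' -> r' <= r -> gauss_le r C P -> gauss_le r' C P.
Proof.
move=> r0 hr hP m; apply: le_trans (hP m); apply: ler_wpM2l; first exact: abs_ge0.
by rewrite lerXn2r ?nnegrE ?(le_trans r0 hr).
Qed.

Lemma gauss_le_ge0 r C P : 0 <= r -> gauss_le r C P -> 0 <= C.
Proof. by move=> r0 /(_ 0%MM); apply: le_trans; apply: mulr_ge0;
  [exact: abs_ge0 | exact: exprn_ge0]. Qed.

Lemma gauss_leC r c : gauss_le r (abs c) c%:MP.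
Proof.
move=> m; rewrite mcoeffC; case: eqP => [->|_].
  by rewrite mulr1 mdeg0 expr0 mulr1.
by rewrite mulr0 abs0 // mul0r abs_ge0.
Qed.

Lemma gauss_leX r i : 0 <= r -> gauss_le r r 'X_i.
Proof.
move=> r0 m; rewrite mcoeffX; case: eqP => [<-|_].
  by rewrite abs1 // mul1r mdeg1 expr1.
by rewrite abs0 // mul0r.
Qed.

Lemma gauss_leD r C P Q : 0 <= r -> gauss_le r C P -> gauss_le r C Q ->
  gauss_le r C (P + Q).
Proof.
move=> r0 hP hQ m; rewrite mcoeffD.
have h := abs_max habs P@_m Q@_m.
apply: le_trans (ler_wpM2r (exprn_ge0 _ r0) h) _.
by rewrite maxr_pMl ?exprn_ge0 // ge_max hP hQ.
Qed.

Lemma gauss_leN r C P : gauss_le r C P -> gauss_le r C (- P).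
Proof. by move=> hP m; rewrite mcoeffN absN. Qed.

Lemma gauss_leB r C P Q : 0 <= r -> gauss_le r C P -> gauss_le r C Q ->
  gauss_le r C (P - Q).
Proof. by move=> r0 hP hQ; apply: gauss_leD => //; apply: gauss_leN. Qed.

Lemma gauss_le_sum r C (I : Type) (s : seq I) (S : pred I) (F : I -> {mpoly K[n]}) :
  0 <= r -> 0 <= C -> (forall i, S i -> gauss_le r C (F i)) ->
  gauss_le r C (\sum_(i <- s | S i) F i).
Proof.
move=> r0 C0 h; elim/big_ind: _ => //.
  by move=> m; rewrite mcoeff0 abs0 // mul0r.
by move=> P Q; apply: gauss_leD.
Qed.

(** In the convolution formula for the coefficient of [m] the degree splits additively, and the
    weight [r ^+ mdeg m] splits along with it. *)
Lemma gauss_leM r C D P Q : 0 <= r -> gauss_le r C P -> gauss_le r D Q ->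
  gauss_le r (C * D) (P * Q).
Proof.
move=> r0 hP hQ m.
have C0 := gauss_le_ge0 r0 hP; have D0 := gauss_le_ge0 r0 hQ.
have [->|rn0] := eqVneq (r ^+ mdeg m) 0; first by rewrite mulr0 mulr_ge0.
have rm0 : 0 < r ^+ mdeg m by rewrite lt_def rn0 exprn_ge0.
rewrite -ler_pdivlMr // mcoeffM; apply: abs_sum_le => //.
  by rewrite divr_ge0 ?mulr_ge0 // ltW.
move=> [k1 k2] /= /eqP hm; rewrite ler_pdivlMr // absM //.
have := ler_pM _ _ (hP k1) (hQ k2);
  have -> : r ^+ mdeg m = r ^+ mdeg k1 * r ^+ mdeg k2 by rewrite {1}hm mdegD exprD.
rewrite !mulr_ge0 ?(abs_ge0 habs) ?exprn_ge0 // => /(_ isT isT).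
by congr (_ <= _); ring.
Qed.

Lemma gauss_le_eval r C P w : 0 <= r -> gauss_le r C P ->
  (forall i, abs (w i) <= r) -> abs P.@[w] <= C.
Proof.
move=> r0 hP hw; rewrite mevalE; apply: abs_sum_le => //.
  exact: gauss_le_ge0 hP.
move=> m _; apply: le_trans (hP m); rewrite absM // abs_prod //.
apply: ler_wpM2l; first exact: abs_ge0.
rewrite mdegE -prodrXr; apply: ler_prod => i _.
rewrite absX //; apply/andP; split; first by rewrite exprn_ge0 ?(abs_ge0 habs).
by apply: lerXn2r; rewrite ?nnegrE ?(abs_ge0 habs).
Qed.

(** Differentiation multiplies a coefficient by an integer, of norm at most 1, and lowers the degree
    by one: the only loss is the factor [1 / r]. *)
Lemma gauss_le_deriv r C i P : 0 < r -> gauss_le r C P ->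
  gauss_le r (C / r) P^`M(i).
Proof.
move=> r0 hP m; rewrite mcoeff_deriv ler_pdivlMr // -mulr_natr absM //.
apply: le_trans (hP (m + U_(i))%MM); rewrite mdegD mdeg1 exprD expr1 mulrA.
apply: ler_wpM2r; first exact: ltW.
apply: ler_wpM2r; first by rewrite exprn_ge0 ?ltW.
by rewrite ler_piMr ?(abs_ge0 habs) // abs_nat.
Qed.

(** The quotient [S] of the remainder by [h ^+ 2] is an integral form of degree [k - 2] in [x] and
    [h]. Keeping [r ^+ 2] on the left covers [r = 0] and also [k < 2], where [S] is 0. *)
Lemma expr_taylor r (x h : K) k : 0 <= r -> abs x <= r -> abs h <= r ->
  exists2 S, (x + h) ^+ k - x ^+ k - h * (k%:R * x ^+ k.-1) = h ^+ 2 * S &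
             abs S * r ^+ 2 <= r ^+ k.
Proof.
move=> r0 hx hh; elim: k => [|k [S hS hSr]].
  by exists 0; [rewrite !expr0; ring | rewrite abs0 // mul0r expr0].
(* What multiplies [h ^+ 2] when the expansion of [(x + h) ^+ k] is multiplied by [x + h]. *)
exists (k%:R * x ^+ k.-1 + (x + h) * S).
  have hS' : (x + h) ^+ k = x ^+ k + h * (k%:R * x ^+ k.-1) + h ^+ 2 * S.
    by rewrite -hS; ring.
  rewrite exprS hS'; case: k {hS hSr hS'} => [|k] /=; first by rewrite !expr0; ring.
  by rewrite -natr1 (exprS x k.+1) (exprS x k); ring.
have r2 : 0 <= r ^+ 2 by rewrite exprn_ge0.
apply: le_trans (ler_wpM2r r2 (abs_max habs _ _)) _.
rewrite maxr_pMl // ge_max; apply/andP; split; last first.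
  rewrite absM // -mulrA (exprS r k); apply: ler_pM => //;
    rewrite ?(abs_ge0 habs) ?mulr_ge0 ?(abs_ge0 habs) //.
  exact: absD_le.
case: k {hS hSr} => [|k] /=; first by rewrite mul0r abs0 // mul0r exprn_ge0.
rewrite -(addn2 k) exprD; apply: ler_wpM2r => //.
rewrite absM // absX //; apply: le_trans (_ : 1 * r ^+ k <= _); last by rewrite mul1r.
by apply: ler_pM;
  rewrite ?(abs_ge0 habs) ?exprn_ge0 ?(abs_ge0 habs) ?abs_nat ?lerXn2r ?nnegrE ?(abs_ge0 habs).
Qed.

Definition shift_coord (i : 'I_n) (h : K) w : 'I_n -> K :=
  fun j => w j + h * (j == i)%:R.

(** The remainder [L] is additive in the polynomial, which reduces the estimate to monomials; there
    only the [i]-th factor moves and [expr_taylor] applies. *)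
Lemma gauss_le_taylor r C P w i h : 0 <= r -> gauss_le r C P ->
  (forall i, abs (w i) <= r) -> abs h <= r ->
  abs (P.@[shift_coord i h w] - P.@[w] - h * P^`M(i).@[w]) * r ^+ 2 <= C * abs h ^+ 2.
Proof.
move=> r0 hP hw hh.
pose L Q := Q.@[shift_coord i h w] - Q.@[w] - h * Q^`M(i).@[w].
have LE : L P = \sum_(m <- msupp P) P@_m * L 'X_[m].
  have LD : {morph L : Q Q' / Q + Q'} by move=> Q Q'; rewrite /L mderivD !mevalD; ring.
  have L0 : L 0 = 0 by rewrite /L mderiv0 !meval0; ring.
  rewrite {1}(mpolyE P) (big_morph L LD L0).
  by apply: eq_bigr => m _; rewrite /L mderivZ !mevalZ; ring.
have hX m : exists2 T, L 'X_[m] = h ^+ 2 * T & abs T * r ^+ 2 <= r ^+ mdeg m.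
  have [S hS hSr] := expr_taylor (m i) r0 (hw i) hh.
  exists ((\prod_(j | j != i) w j ^+ m j) * S).
    rewrite /L mderivX mevalZ !mevalX.
    set Y := \prod_(j | j != i) _.
    have -> : \prod_j shift_coord i h w j ^+ m j = (w i + h) ^+ m i * Y.
      rewrite (bigD1 i) //= /shift_coord eqxx mulr1; congr (_ * _).
      by apply: eq_bigr => j /negPf ->; rewrite mulr0 addr0.
    have -> : \prod_j w j ^+ (m - U_(i))%MM j = w i ^+ (m i).-1 * Y.
      rewrite (bigD1 i) //= mnmBE mnm1E eqxx subn1; congr (_ * _).
      by apply: eq_bigr => j /negPf ji; rewrite mnmBE mnm1E eq_sym ji subn0.
    rewrite (bigD1 i) //= -/Y.
    have -> : (w i + h) ^+ m i =
        w i ^+ m i + h * ((m i)%:R * w i ^+ (m i).-1) + h ^+ 2 * S by rewrite -hS; ring.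
    by ring.
  have -> : mdeg m = (m i + \sum_(j | j != i) m j)%N by rewrite mdegE (bigD1 i).
  rewrite exprD absM // -mulrA mulrC.
  apply: ler_pM => //; rewrite ?mulr_ge0 ?(abs_ge0 habs) ?exprn_ge0 //.
  rewrite abs_prod // -prodrXr; apply: ler_prod => j _.
  rewrite absX //; apply/andP; split; first by rewrite exprn_ge0 ?(abs_ge0 habs).
  by apply: lerXn2r; rewrite ?nnegrE ?(abs_ge0 habs).
have C0 := gauss_le_ge0 r0 hP.
rewrite -/(L P) LE.
have [->|rn0] := eqVneq r 0; first by rewrite expr0n mulr0 mulr_ge0 ?exprn_ge0 ?(abs_ge0 habs).
have r20 : 0 < r ^+ 2 by rewrite exprn_gt0 // lt_def rn0.
rewrite -ler_pdivlMr //; apply: abs_sum_le => //.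
  by rewrite !mulr_ge0 ?exprn_ge0 ?(abs_ge0 habs) // invr_ge0 ltW.
move=> m _; rewrite ler_pdivlMr //; have [T -> hT] := hX m.
rewrite (absM habs P@_m) (absM habs _ T) (absX habs h).
have := ler_wpM2l (abs_ge0 habs P@_m) hT => /le_trans/(_ (hP m)) hm.
have h2 : 0 <= abs h ^+ 2 by rewrite exprn_ge0 ?(abs_ge0 habs).
have := ler_wpM2r h2 hm; apply: le_trans.
by rewrite le_eqVlt; apply/orP; left; apply/eqP; ring.
Qed.

End GaussNorm.

(** * Analytic functions *)

Section AnalyticFunctions.
Variables (R : realType) (K : fieldType) (abs : K -> R) (n : nat).
Hypothesis habs : nonarch_abs abs.
Hypothesis abs_nondiscrete : forall e : R, 0 < e -> exists2 h : K, h != 0 & abs h < e.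
Hypothesis habs_complete : abs_complete abs.
Hypothesis natS_neq0 : forall k, k.+1%:R != 0 :> K.
Implicit Types (P : nat -> {mpoly K[n]}) (w : 'I_n -> K) (r C : R).
Implicit Types (f : 'rV[K]_n -> K) (z b : 'rV[K]_n).

Definition polydisc b r z : Prop := forall i, abs (z 0 i - b 0 i) <= r.

Definition offset b z : 'I_n -> K := fun i => z 0 i - b 0 i.

(** The working form of analyticity: the variables of [P s] stand for the displacement from [b], the
    Gauss bound is uniform in [s], the convergence only pointwise. This form passes directly through
    products and derivatives. *)
Definition poly_approx C r b f P : Prop :=
  (forall s, gauss_le abs r C (P s)) /\
  forall z, polydisc b r z -> abs_cvg abs (fun s => (P s).@[offset b z]) (f z).

Lemma polydisc_center b r : 0 <= r -> polydisc b r b.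
Proof. by move=> r0 i; rewrite subrr abs0. Qed.

Lemma polydisc_le b r r' z : r <= r' -> polydisc b r z -> polydisc b r' z.
Proof. by move=> hr hz i; apply: le_trans hr. Qed.

Lemma offset_shift b i h z : offset b (z + h *: delta_mx 0 i) =1 shift_coord i h (offset b z).
Proof. by move=> j; rewrite /offset /shift_coord !mxE eqxx addrAC. Qed.

Lemma polydisc_shift b r i h z : polydisc b r z -> abs h <= r ->
  polydisc b r (z + h *: delta_mx 0 i).
Proof.
move=> hz hh j; rewrite -/(offset b _ j) offset_shift /shift_coord.
apply: absD_le => //; first exact: hz.
by case: (j == i); rewrite ?mulr1 // mulr0 abs0 // (le_trans _ hh) // abs_ge0.
Qed.

(** The estimate depends on [Q] only through [C], so that one step [h] serves all the members of a
    family with a common Gauss bound. *)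
Lemma quotient_taylor C r (Q : {mpoly K[n]}) w i h : 0 < r -> gauss_le abs r C Q ->
  (forall j, abs (w j) <= r) -> h != 0 -> abs h <= r ->
  abs ((Q.@[shift_coord i h w] - Q.@[w]) / h - Q^`M(i).@[w]) <= C / r ^+ 2 * abs h.
Proof.
move=> r0 hQ hw h0 hh.
have := gauss_le_taylor habs i (ltW r0) hQ hw hh.
have -> : Q.@[shift_coord i h w] - Q.@[w] - h * Q^`M(i).@[w] =
   h * ((Q.@[shift_coord i h w] - Q.@[w]) / h - Q^`M(i).@[w]) by field.
set T := (X in h * X); rewrite (absM habs) => h1.
have ah : 0 < abs h by rewrite (abs_gt0 habs).
rewrite mulrAC ler_pdivlMr ?exprn_gt0 // -(ler_pM2l ah) mulrA.
by apply: le_trans h1 _; rewrite le_eqVlt; apply/orP; left; apply/eqP; ring.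
Qed.

Lemma exists_small_shift C r e : 0 < r -> 0 < e ->
  exists h : K, [/\ h != 0, abs h <= r & C / r ^+ 2 * abs h < e].
Proof.
move=> r0 e0; pose c := `|C / r ^+ 2| + 1.
have c0 : 0 < c by rewrite ltr_wpDl.
have m0 : 0 < Num.min r (e / c) by rewrite lt_min r0 divr_gt0.
have [h h0] := abs_nondiscrete m0; rewrite lt_min => /andP[h1 h2].
exists h; split=> //; first exact: ltW.
apply: le_lt_trans (_ : c * abs h < e); last by rewrite mulrC -ltr_pdivlMr.
apply: ler_wpM2r; first exact: abs_ge0.
by rewrite /c; have := ler_norm (C / r ^+ 2); lra.
Qed.

(** By the uniform Gauss bound, difference quotients with one fixed small step
    are close to the derivatives of all the [P s] at once. *)
Lemma deriv_cauchy C r P i : 0 < r -> (forall s, gauss_le abs r C (P s)) ->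
  (forall w, (forall j, abs (w j) <= r) -> abs_cauchy abs (fun s => (P s).@[w])) ->
  forall w, (forall j, abs (w j) <= r) -> abs_cauchy abs (fun s => (P s)^`M(i).@[w]).
Proof.
move=> r0 hP hc w hw e e0.
have [h [h0 hh he]] := exists_small_shift C r0 e0.
have ah : 0 < abs h by rewrite (abs_gt0 habs).
have hw' j : abs (shift_coord i h w j) <= r.
  apply: absD_le => //; case: (j == i); rewrite ?mulr1 // mulr0 abs0 //; exact: ltW.
have eh0 : 0 < e * abs h by rewrite mulr_gt0.
have [N1 hN1] := hc _ hw' _ eh0; have [N2 hN2] := hc _ hw _ eh0.
exists (maxn N1 N2) => s t; rewrite !geq_max => /andP[s1 s2] /andP[t1 t2].
have hq u := le_lt_trans (quotient_taylor i r0 (hP u) hw h0 hh) he.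
apply: (abs_dist_lt habs (y := ((P s).@[shift_coord i h w] - (P s).@[w]) / h)).
  by rewrite abs_distC.
apply: (abs_dist_lt habs (y := ((P t).@[shift_coord i h w] - (P t).@[w]) / h)) => //.
rewrite -mulrBl absM // absV // ltr_pdivrMr //.
have hE (x y x' y' : K) : x - y - (x' - y') = (x - x') - (y - y') by ring.
by rewrite hE; apply: absD_lt => //; [apply: hN1 | rewrite absN //; apply: hN2].
Qed.

Lemma meval_at0 (Q : {mpoly K[n]}) : Q.@[fun=> 0] = Q@_0.
Proof.
rewrite {1}(mpolyE Q) raddf_sum /=.
have E m' : ('X_[m'] : {mpoly K[n]}).@[fun=> 0] = (m' == 0%MM)%:R.
  rewrite mevalX; have [->|m0] := eqVneq m' 0%MM.
    by rewrite big1 // => j _; rewrite mnm0E.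
  have [j hj] : exists j, m' j != 0%N.
    apply/existsP; rewrite -negb_forall; apply: contra m0 => /forallP h.
    by apply/eqP/mnmP => j; rewrite mnm0E; apply/eqP.
  by rewrite (bigD1 j) //= expr0n (negPf hj) mul0r.
rewrite (eq_bigr (fun m' => if m' == 0%MM then Q@_m' else 0)); last first.
  by move=> m' _; rewrite mevalZ E; case: eqP; rewrite ?mulr1 ?mulr0.
rewrite -big_mkcond /=; case: (boolP (0%MM \in msupp Q)) => h0.
  by rewrite (big_rem _ h0) /= eqxx big_seq_cond big1 ?addr0 // => m'
     /andP[]; rewrite mem_rem_uniq ?msupp_uniq // inE => /andP[/negPf->].
rewrite big_seq_cond big1 ?memN_msupp_eq0 // => m' /andP[h1 /eqP h2].
by rewrite -h2 h1 in h0.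
Qed.

(** Differentiation brings the coefficient of [m] down to degree 0, where it is the value at the
    center. Each step introduces an integer factor [m i], nonzero in [K]; its norm may be small, but
    the Cauchy property survives division by a fixed constant. *)
Lemma coef_cauchy C r P m : 0 < r -> (forall s, gauss_le abs r C (P s)) ->
  (forall w, (forall j, abs (w j) <= r) -> abs_cauchy abs (fun s => (P s).@[w])) ->
  abs_cauchy abs (fun s => (P s)@_m).
Proof.
move=> r0; move Ed : (mdeg m) => d; elim: d m Ed C P => [|d IH] m Ed C P hP hc.
  have -> : m = 0%MM by apply/eqP; rewrite -mdeg_eq0 Ed.
  have hw0 (j : 'I_n) : abs 0 <= r by rewrite abs0 // ltW.
  move=> e /(hc _ hw0)[N hN].
  by exists N => s t hs ht; rewrite -!meval_at0 hN.
have [i hi] : exists i, m i != 0%N.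
  apply/existsP; rewrite -negb_forall; apply: contraT => /negPn/forallP h.
  have m0 : m = 0%MM by apply/mnmP => j; rewrite mnm0E; apply/eqP.
  by rewrite m0 mdeg0 in Ed.
have hm : m = (m - U_(i) + U_(i))%MM.
  by apply/mnmP => j; rewrite mnmDE mnmBE mnm1E; case: eqP => [<-|];
    rewrite ?subn0 ?addn0 // subnK // lt0n.
have hd : mdeg (m - U_(i))%MM = d.
  by move: Ed; rewrite {1}hm mdegD mdeg1 addn1 => -[].
have := IH _ hd (C / r) (fun s => (P s)^`M(i)) (fun s => gauss_le_deriv habs i r0 (hP s))
  (deriv_cauchy i r0 hP hc).
set k := ((m - U_(i))%MM i).+1.
have hk : 0 < abs k%:R by rewrite (abs_gt0 habs) natS_neq0.
move=> hcd e e0; have ek : 0 < e * abs k%:R by rewrite mulr_gt0.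
have [N hN] := hcd _ ek; exists N => s t hs ht; have := hN s t hs ht.
by rewrite !mcoeff_deriv -hm -/k -mulrnBl -[(_ - _) *+ k]mulr_natr (absM habs _ k%:R) ltr_pM2r.
Qed.

(** * Power series against polynomial approximations *)

Definition exponents (m : 'X_{1..n}) : multi_index n := [ffun i => m i].

Lemma mi_degree_exponents m : mi_degree (exponents m) = mdeg m.
Proof. by rewrite mdegE; apply: eq_bigr => i _; rewrite ffunE. Qed.

Lemma exponents_multinom (al : multi_index n) : exponents [multinom al i | i < n] = al.
Proof. by apply/ffunP => i; rewrite ffunE mnmE. Qed.

Definition box_poly (a : multi_index n -> K) N : {mpoly K[n]} :=
  \sum_(al : {ffun 'I_n -> 'I_N})
     a [ffun i => al i : nat] *: 'X_[ [multinom (al i : nat) | i < n] ].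

Lemma coef_box_poly a N m :
  (box_poly a N)@_m = if [forall i, m i < N]%N then a (exponents m) else 0.
Proof.
rewrite raddf_sum /=; case: ifPn => [/forallP hm | hm].
  pose al0 : {ffun 'I_n -> 'I_N} := [ffun i => Ordinal (hm i)].
  rewrite (bigD1 al0) //= mcoeffZ mcoeffX big1 ?addr0.
    rewrite (_ : _ == _ = true) ?mulr1; last first.
      by apply/eqP/mnmP => i; rewrite mnmE ffunE.
    by congr a; apply/ffunP => i; rewrite !ffunE.
  move=> al hal; rewrite mcoeffZ mcoeffX; case: eqP => [E|_]; last by rewrite mulr0.
  case/eqP: hal; apply/ffunP => i; apply: val_inj; rewrite ffunE /= -E mnmE.
  by [].
rewrite big1 // => al _; rewrite mcoeffZ mcoeffX; case: eqP => [E|_]; last by rewrite mulr0.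
by case/negP: hm; apply/forallP => i; rewrite -E mnmE.
Qed.

Lemma eval_box_poly a N b z :
  (box_poly a N).@[offset b z] = power_series_sum a b z N.
Proof.
rewrite raddf_sum; apply: eq_bigr => al _ /=; rewrite mevalZ mevalX; congr (_ * _).
by apply: eq_bigr => i _; rewrite mnmE.
Qed.

Lemma box_large_degree N (m : 'X_{1..n}) : ~~ [forall i, m i < N]%N -> (N <= mdeg m)%N.
Proof.
case/forallPn => i; rewrite -leqNgt => h; apply: leq_trans h _.
by rewrite mdegE (bigD1 i) //= leq_addr.
Qed.

(** The limits of the coefficients inherit the bound [C] at radius [r], so at radius [r / 2] the
    terms decay like [C / 2^d]. To compare a truncation with [f z], an index [s] is chosen for which
    [P s] is close to [f] at [z] and to the truncation in its finitely many coefficients; all the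
    others are small by decay. *)
Lemma approx_analytic C r b f P : 0 < r -> poly_approx C r b f P -> analytic_at abs f b.
Proof.
move=> r0 [hP hf].
have C0 : 0 <= C by apply: gauss_le_ge0 (hP 0%N) => //; exact: ltW.
have hc w : (forall j, abs (w j) <= r) -> abs_cauchy abs (fun s => (P s).@[w]).
  move=> hw; pose z := b + \row_i w i.
  have E : offset b z =1 w by move=> i; rewrite /offset !mxE addrAC subrr add0r.
  have hz : polydisc b r z by move=> i; rewrite -/(offset b z i) E.
  move=> e /(cvg_cauchy habs (hf z hz))[N hN]; exists N => s t hs ht.
  by rewrite -!(meval_eq _ E) hN.
have hcoef (al : multi_index n) :
    exists c, abs_cvg abs (fun s => (P s)@_[multinom al i | i < n]) c.
  exact/habs_complete/(coef_cauchy _ r0 hP hc).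
have [a ha] := choice hcoef.
have haC m : abs (a (exponents m)) * r ^+ mdeg m <= C.
  have rm : 0 < r ^+ mdeg m by rewrite exprn_gt0.
  rewrite -ler_pdivlMr //; apply: (cvg_le habs _ (ha _)).
  by exists 0%N => s _; rewrite ler_pdivlMr //; have := hP s m;
    congr (abs (mcoeff _ _) * _ <= _);
    apply/mnmP => i; rewrite mnmE ffunE.
pose q := r / 2%:R.
have q0 : 0 < q by rewrite divr_gt0 // ltr0n.
have hq : q <= r by rewrite ler_pdivrMr ?ltr0n //; lra.
have half0 : 0 <= 2%:R^-1 :> R by rewrite invr_ge0 ler0n.
have half1 : 2%:R^-1 < 1 :> R by lra.
have hdecay c d : c * r ^+ d <= C -> c * q ^+ d <= C * 2%:R^-1 ^+ d.
  by move=> h; rewrite /q exprMn mulrA ler_wpM2r // exprn_ge0.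
have hsmall e : 0 < e -> exists N, forall d, (N <= d)%N -> C * 2%:R^-1 ^+ d < e.
  move=> e0; have C1 : 0 < C + 1 by lra.
  have [N hN] := expr_eventually_lt half0 half1 (divr_gt0 e0 C1).
  exists N => d /hN; rewrite ltr_pdivlMr // => h; apply: le_lt_trans h.
  by rewrite mulrC ler_wpM2l ?exprn_ge0 //; lra.
exists a, q; split=> // [e e0 | z hz].
  have [N hN] := hsmall e e0; exists N => al hal; apply: le_lt_trans (hN _ hal).
  rewrite -{1 2 3}[al]exponents_multinom !mi_degree_exponents; apply: hdecay; exact: haC.
move=> e e0; have e20 : 0 < e / 2%:R by rewrite divr_gt0 // ltr0n.
have [N0 hN0] := hsmall _ e20; exists N0 => N hN.
have [s [hs1 hs2]] : exists s, abs ((P s).@[offset b z] - f z) < e /\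
    forall al : {ffun 'I_n -> 'I_N},
      abs ((P s)@_[multinom (al i : nat) | i < n] - a [ffun i => al i : nat])
        * q ^+ mdeg [multinom (al i : nat) | i < n] < e / 2%:R.
  have h1 := hf z (polydisc_le hq hz) e e0.
  have h2 : eventually (fun s => forall al : {ffun 'I_n -> 'I_N},
      abs ((P s)@_[multinom (al i : nat) | i < n] - a [ffun i => al i : nat])
        * q ^+ mdeg [multinom (al i : nat) | i < n] < e / 2%:R).
    apply: eventually_forall => al.
    have qm : 0 < q ^+ mdeg [multinom (al i : nat) | i < n] by rewrite exprn_gt0.
    apply: eventuallyW (ha [ffun i => al i : nat] _ (divr_gt0 e20 qm)) => s.
    rewrite ltr_pdivlMr // (_ : [multinom [ffun i => al i : nat] i | i < n]
      = [multinom (al i : nat) | i < n]) //.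
    by apply/mnmP => i; rewrite !mnmE ffunE.
  by have [M hM] := eventually_and h1 h2; exists M; apply: hM.
apply: (abs_dist_lt habs) hs1; rewrite abs_distC // -eval_box_poly -mevalB.
apply: le_lt_trans (_ : e / 2%:R < e); last by lra.
apply: (gauss_le_eval habs (ltW q0)) => [m|i]; last exact: hz.
rewrite mcoeffB coef_box_poly; case: ifPn => [/forallP hm|hm].
  pose al : {ffun 'I_n -> 'I_N} := [ffun i => Ordinal (hm i)].
  have Em : m = [multinom (al i : nat) | i < n] by apply/mnmP => i; rewrite mnmE ffunE.
  have Ea : exponents m = [ffun i => al i : nat] by apply/ffunP => i; rewrite !ffunE.
  by apply: ltW; have := hs2 al; rewrite -Em -Ea.
rewrite subr0; apply: le_trans (hdecay _ _ (hP s m)) _.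
by apply: ltW; apply: hN0; apply: leq_trans hN _; apply: box_large_degree.
Qed.

Lemma analytic_approx f b : analytic_at abs f b ->
  exists C r P, 0 < r /\ poly_approx C r b f P.
Proof.
move=> [a [r [r0 ha hf]]].
have [N hN] := ha 1 ltr01.
(* Terms outside the box of side [N] are below 1 by the choice of [N]; each of the finitely many
   terms inside is bounded by the sum. *)
pose C := 1 + \sum_(al : {ffun 'I_n -> 'I_N})
   abs (a [ffun i => al i : nat]) * r ^+ mi_degree [ffun i => al i : nat].
have T0 (al : {ffun 'I_n -> 'I_N}) :
    0 <= abs (a [ffun i => al i : nat]) * r ^+ mi_degree [ffun i => al i : nat].
  by rewrite mulr_ge0 ?(abs_ge0 habs) // exprn_ge0 // ltW.
have C1 : 1 <= C by rewrite lerDl; apply: sumr_ge0.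
have haC m : abs (a (exponents m)) * r ^+ mdeg m <= C.
  have [hm|hm] := boolP [forall i, m i < N]%N.
    pose al : {ffun 'I_n -> 'I_N} := [ffun i => Ordinal (forallP hm i)].
    have Ea : exponents m = [ffun i => al i : nat] by apply/ffunP => i; rewrite !ffunE.
    rewrite -mi_degree_exponents Ea /C (bigD1 al) //= addrCA lerDl addr_ge0 //.
    by apply: sumr_ge0.
  have := hN (exponents m); rewrite mi_degree_exponents => h.
  by apply: le_trans (ltW (h (box_large_degree hm))) _.
exists C, r, (box_poly a); split=> //; split=> [M m | z hz].
  rewrite coef_box_poly; case: ifP => // _.
  by rewrite abs0 // mul0r; apply: le_trans (haC 0%MM);
    rewrite mulr_ge0 ?(abs_ge0 habs) // exprn_ge0 // ltW.
by apply: cvg_eventually (hf z hz); exists 0%N => M _; rewrite eval_box_poly.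
Qed.

Lemma poly_approx_radius C r r' b f P : 0 <= r' -> r' <= r ->
  poly_approx C r b f P -> poly_approx C r' b f P.
Proof.
move=> r0 hr [hP hf]; split=> [s | z hz]; first exact: gauss_le_radius (hP s).
exact/hf/polydisc_le/hz.
Qed.

Lemma analytic_at_ext f f' b r : 0 < r -> (forall z, polydisc b r z -> f z = f' z) ->
  analytic_at abs f b -> analytic_at abs f' b.
Proof.
move=> r0 E [a [q [q0 ha hf]]].
have m0 : 0 < Num.min q r by rewrite lt_min q0 r0.
exists a, (Num.min q r); split=> // [e e0 | z hz].
  have [N hN] := ha e e0; exists N => al /hN; apply: le_lt_trans.
  rewrite ler_wpM2l ?(abs_ge0 habs) // lerXn2r ?nnegrE ?(ltW m0) ?(ltW q0) //.
  by rewrite ge_min lexx.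
rewrite -E; last by apply: polydisc_le hz; rewrite ge_min lexx orbT.
by apply: hf; apply: polydisc_le hz; rewrite ge_min lexx.
Qed.

Lemma analytic_at_poly (Q : {mpoly K[n]}) b :
  analytic_at abs (fun z => Q.@[offset b z]) b.
Proof.
pose C := \sum_(m <- msupp Q) abs Q@_m.
apply: (@approx_analytic C 1 b _ (fun=> Q)) => //; split=> [_ m|z _]; last exact: cvg_cst.
rewrite expr1n mulr1 /C; have C0 := abs_ge0 habs.
case: (boolP (m \in msupp Q)) => hm; last by rewrite memN_msupp_eq0 // abs0 // sumr_ge0.
by rewrite (big_rem _ hm) /= lerDl sumr_ge0.
Qed.

Lemma common_approx f f' b : analytic_at abs f b -> analytic_at abs f' b ->
  exists C C' r P P',
    [/\ 0 < r, poly_approx C r b f P & poly_approx C' r b f' P'].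
Proof.
move=> /analytic_approx[C [r [P [r0 hP]]]] /analytic_approx[C' [r' [P' [r'0 hP']]]].
have m0 : 0 < Num.min r r' by rewrite lt_min r0 r'0.
exists C, C', (Num.min r r'), P, P'; split=> //.
  by apply: poly_approx_radius hP; rewrite ?(ltW m0) // ge_min lexx.
by apply: poly_approx_radius hP'; rewrite ?(ltW m0) // ge_min lexx orbT.
Qed.

Lemma analytic_atD f f' b : analytic_at abs f b -> analytic_at abs f' b ->
  analytic_at abs (fun z => f z + f' z) b.
Proof.
move=> hf hf'; have [C [C' [r [P [P' [r0 [hP1 hf1] [hP2 hf2]]]]]]] := common_approx hf hf'.
apply: (@approx_analytic (Num.max C C') r b _ (fun s => P s + P' s)) => //.
split=> [s | z hz].
  apply: (gauss_leD habs (ltW r0)).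
    by apply: gauss_leW (hP1 s); rewrite le_max lexx.
  by apply: gauss_leW (hP2 s); rewrite le_max lexx orbT.
apply: cvg_eventually (cvgD habs (hf1 z hz) (hf2 z hz)).
by exists 0%N => s _; rewrite mevalD.
Qed.

Lemma poly_approxM C C' r b f f' P P' : 0 < r ->
  poly_approx C r b f P -> poly_approx C' r b f' P' ->
  poly_approx (C * C') r b (fun z => f z * f' z) (fun s => P s * P' s).
Proof.
move=> r0 [hP1 hf1] [hP2 hf2].
split=> [s | z hz]; first exact: (gauss_leM habs (ltW r0)).
apply: cvg_eventually (cvgM habs (hf1 z hz) (hf2 z hz)).
by exists 0%N => s _; rewrite mevalM.
Qed.

Lemma analytic_atM f f' b : analytic_at abs f b -> analytic_at abs f' b ->
  analytic_at abs (fun z => f z * f' z) b.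
Proof.
move=> hf hf'; have [C [C' [r [P [P' [r0 h h']]]]]] := common_approx hf hf'.
exact: approx_analytic r0 (poly_approxM r0 h h').
Qed.

Lemma analytic_at_cst c b : analytic_at abs (fun=> c) b.
Proof.
apply: (@analytic_at_ext _ _ b 1 ltr01 _ (analytic_at_poly c%:MP b)) => z _.
by rewrite mevalC.
Qed.

Lemma analytic_at_sum (I : Type) (s : seq I) (S : pred I) (F : I -> 'rV[K]_n -> K) b :
  (forall i, S i -> analytic_at abs (F i) b) ->
  analytic_at abs (fun z => \sum_(i <- s | S i) F i z) b.
Proof.
move=> h; elim: s => [|i s IH].
  by apply: (analytic_at_ext ltr01 _ (analytic_at_cst 0 b)) => z _; rewrite big_nil.
case Si: (S i).
  apply: (analytic_at_ext ltr01 _ (analytic_atD (h i Si) IH)) => z _.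
  by rewrite big_cons Si.
by apply: (analytic_at_ext ltr01 _ IH) => z _; rewrite big_cons Si.
Qed.

(** * Partial derivatives *)

Lemma is_partial_unique i f z l l' :
  is_partial abs i f z l -> is_partial abs i f z l' -> l = l'.
Proof.
move=> hl hl'; apply/eqP; rewrite -subr_eq0 -(abs_eq0 habs) eq_le (abs_ge0 habs) andbT.
rewrite leNgt; apply/negP => e0.
have [d d0 hd] := hl _ e0; have [d' d'0 hd'] := hl' _ e0.
have m0 : 0 < Num.min d d' by rewrite lt_min d0 d'0.
have [h h0] := abs_nondiscrete m0; rewrite lt_min => /andP[h1 h2].
have := hd h h0 h1; rewrite abs_distC // => h3.
by have := abs_dist_lt habs h3 (hd' h h0 h2); rewrite ltxx.
Qed.

Lemma is_partial_ext i f f' z l r : 0 < r -> (forall y, polydisc z r y -> f y = f' y) ->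
  is_partial abs i f z l -> is_partial abs i f' z l.
Proof.
move=> r0 E hl e e0; have [d d0 hd] := hl e e0.
exists (Num.min d r) => [|h h0]; first by rewrite lt_min d0 r0.
rewrite lt_min => /andP[h1 h2]; have z0 := polydisc_center z (ltW r0).
by rewrite -!E //; [apply: hd | apply: polydisc_shift => //; apply: ltW].
Qed.

(** The Taylor estimate is uniform in [s], so it passes to the limit: the limit of the derivatives
    is the derivative of the limit, on the whole polydisc and without loss of radius. *)
Lemma approx_partial C r b f P i : 0 < r -> poly_approx C r b f P ->
  exists df, (forall z, polydisc b r z -> is_partial abs i f z (df z)) /\
             poly_approx (C / r) r b df (fun s => (P s)^`M(i)).
Proof.
move=> r0 [hP hf].
have hd z : polydisc b r z ->
    exists l, abs_cvg abs (fun s => (P s)^`M(i).@[offset b z]) l.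
  move=> hz; apply: habs_complete; apply: (deriv_cauchy i r0 hP) => // w hw.
  pose y := b + \row_i w i.
  have E : offset b y =1 w by move=> j; rewrite /offset !mxE addrAC subrr add0r.
  have hy : polydisc b r y by move=> j; rewrite -/(offset b y j) E.
  move=> e /(cvg_cauchy habs (hf y hy))[N hN]; exists N => s t hs ht.
  by rewrite -!(meval_eq _ E) hN.
have hex z : exists l, polydisc b r z ->
    abs_cvg abs (fun s => (P s)^`M(i).@[offset b z]) l.
  have [/hd[l hl]|hz] := pselect (polydisc b r z); first by exists l.
  by exists 0.
have [df hdf] := choice hex.
exists df; split; last by split=> // s; apply: (gauss_le_deriv habs).
move=> z hz e e0; have [h1 [h10 hh1 he]] := exists_small_shift C r0 e0.
exists (abs h1) => [|h h0 hh]; first by rewrite (abs_gt0 habs).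
have hhr : abs h <= r := le_trans (ltW hh) hh1.
have C0 : 0 <= C by apply: gauss_le_ge0 (hP 0%N) => //; exact: ltW.
apply: le_lt_trans he; apply: le_trans (_ : C / r ^+ 2 * abs h <= _); last first.
  by rewrite ler_wpM2l ?(ltW hh) // divr_ge0 // exprn_ge0 // ltW.
pose q s := ((P s).@[shift_coord i h (offset b z)] - (P s).@[offset b z]) / h
   - (P s)^`M(i).@[offset b z].
have hq : abs_cvg abs q ((f (z + h *: delta_mx 0 i) - f z) / h - df z).
  apply: (cvgB habs) (hdf z hz).
  apply: (cvgM habs) (cvg_cst habs _); apply: (cvgB habs) (hf z hz).
  apply: cvg_eventually (hf _ (polydisc_shift i hz hhr)).
  by exists 0%N => s _; apply: meval_eq => j; rewrite offset_shift.
apply: (cvg_le habs) hq; exists 0%N => s _.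
exact: (quotient_taylor i r0 (hP s)).
Qed.

Lemma approx_partial_cvg C r b f P i l : 0 < r -> poly_approx C r b f P ->
  is_partial abs i f b l -> abs_cvg abs (fun s => (P s)^`M(i).@[offset b b]) l.
Proof.
move=> r0 hP hl; have [d [hd [_ hPd]]] := approx_partial i r0 hP.
have hb := polydisc_center b (ltW r0).
by rewrite (is_partial_unique hl (hd b hb)); apply: hPd.
Qed.

Lemma is_partialD i f f' z l l' : is_partial abs i f z l -> is_partial abs i f' z l' ->
  is_partial abs i (fun y => f y + f' y) z (l + l').
Proof.
move=> hl hl' e e0; have [d d0 hd] := hl e e0; have [d' d'0 hd'] := hl' e e0.
exists (Num.min d d') => [|h h0]; first by rewrite lt_min d0 d'0.
rewrite lt_min => /andP[h1 h2].
have -> : (f (z + h *: delta_mx 0 i) + f' (z + h *: delta_mx 0 i) - (f z + f' z)) / h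
    - (l + l') =
  ((f (z + h *: delta_mx 0 i) - f z) / h - l) +
  ((f' (z + h *: delta_mx 0 i) - f' z) / h - l') by field.
by apply: absD_lt; [| apply: hd | apply: hd'].
Qed.

Lemma is_partial_sum (I : Type) (s : seq I) (F : I -> 'rV[K]_n -> K) i z (l : I -> K) :
  (forall j, is_partial abs i (F j) z (l j)) ->
  is_partial abs i (fun y => \sum_(j <- s) F j y) z (\sum_(j <- s) l j).
Proof.
move=> h; elim: s => [|j s IH].
  move=> e e0; exists 1 => // d _ _.
  by rewrite !big_nil subrr mul0r subrr abs0.
rewrite big_cons; apply: (is_partial_ext ltr01 _ (is_partialD (h j) IH)) => y _.
by rewrite big_cons.
Qed.

(** Read off the approximations: the derivative of the product is the limit of the derivatives of
    [P s * P' s], to which the Leibniz rule for polynomials applies. *)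
Lemma is_partialM i f f' z l l' : analytic_at abs f z -> analytic_at abs f' z ->
  is_partial abs i f z l -> is_partial abs i f' z l' ->
  is_partial abs i (fun y => f y * f' y) z (l * f' z + f z * l').
Proof.
move=> hf hf' hl hl'; have [C [C' [r [P [P' [r0 h h']]]]]] := common_approx hf hf'.
have hM := poly_approxM r0 h h'; have hz := polydisc_center z (ltW r0).
have [d [hd [_ hPd]]] := approx_partial i r0 hM.
have := hd z hz; suff -> : d z = l * f' z + f z * l' by [].
apply: (cvg_unique habs (hPd z hz)).
have hP := approx_partial_cvg r0 h hl; have hP' := approx_partial_cvg r0 h' hl'.
have := cvgD habs (cvgM habs hP (proj2 h' z hz)) (cvgM habs (proj2 h z hz) hP').
by apply: cvg_eventually; exists 0%N => s _; rewrite mderivM mevalD !mevalM.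
Qed.

Lemma open_polydisc (U : set 'rV[K]_n) b : open_set abs U -> U b ->
  exists2 r, 0 < r & forall z, polydisc b r z -> U z.
Proof.
move=> hU /hU[r r0 h]; exists (r / 2%:R); first by rewrite divr_gt0 // ltr0n.
by move=> z hz; apply: h => i; apply: le_lt_trans (hz i) _; lra.
Qed.

(** The derivative is picked point by point on [U]; near each point, uniqueness identifies it with
    the limit of polynomials given by [approx_partial]. *)
Lemma analytic_on_partial (U : set 'rV[K]_n) f i : open_set abs U ->
  analytic_on abs f U ->
  exists2 df, analytic_on abs df U & forall z, U z -> is_partial abs i f z (df z).
Proof.
move=> hU hf.
have hex z : exists l, U z -> is_partial abs i f z l.
  have [Uz|Uz] := pselect (U z); last by exists 0.
  have [C [r [P [r0 hP]]]] := analytic_approx (hf z Uz).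
  have [d [hd _]] := approx_partial i r0 hP.
  by exists (d z) => _; apply/hd/polydisc_center/ltW.
have [df hdf] := choice hex.
exists df => // b Ub; have [C [r [P [r0 hP]]]] := analytic_approx (hf b Ub).
have [d [hd hPd]] := approx_partial i r0 hP.
have [q q0 hq] := open_polydisc hU Ub.
have m0 : 0 < Num.min r q by rewrite lt_min r0 q0.
apply: (analytic_at_ext m0) (approx_analytic r0 hPd) => z hz.
apply: is_partial_unique (hd z _) (hdf z (hq z _)); apply: polydisc_le hz.
  by rewrite ge_min lexx.
by rewrite ge_min lexx orbT.
Qed.

(** Approximates the inverse of [Q] wherever [Q] is close to [c]. *)
Definition geometric_inverse (Q : {mpoly K[n]}) (c : K) s : {mpoly K[n]} :=
  c^-1 *: \sum_(k < s) (1 - c^-1 *: Q) ^+ k.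

Lemma geometric_inverseE Q c s : c != 0 ->
  Q * geometric_inverse Q c s = 1 - (1 - c^-1 *: Q) ^+ s.
Proof.
move=> c0; rewrite -opprB subrX1 /geometric_inverse -scalerAr scalerAl.
by set S := \sum_(_ < _) _; rewrite addrC addKr mulNr opprK.
Qed.

Section GeometricInverse.
Variables (Q : {mpoly K[n]}) (c : K) (r rho : R).
Hypotheses (r0 : 0 < r) (c0 : c != 0) (rho0 : 0 <= rho) (rho1 : rho < 1).
Hypothesis hQ : gauss_le abs r (rho * abs c) (Q - c%:MP).

Lemma gauss_le_geometric_ratio : gauss_le abs r rho (1 - c^-1 *: Q).
Proof.
have ac : 0 < abs c by rewrite (abs_gt0 habs).
have -> : 1 - c^-1 *: Q = - (c^-1 *: (Q - c%:MP)).
  by rewrite scalerBr -mul_mpolyC -[_ *: c%:MP]mul_mpolyC -mpolyCM mulVf // mpolyC1 opprB.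
by move=> m; rewrite mcoeffN mcoeffZ absN // (absM habs) absV // -mulrA mulrC ler_pdivrMr.
Qed.

Lemma gauss_leXn C (S : {mpoly K[n]}) k :
  gauss_le abs r C S -> gauss_le abs r (C ^+ k) (S ^+ k).
Proof.
move=> h; elim: k => [|k IH]; last by rewrite !exprS; apply: (gauss_leM habs (ltW r0)).
by rewrite !expr0 -(abs1 habs) -mpolyC1; apply: gauss_leC.
Qed.

Lemma gauss_le_geometric_inverse s : gauss_le abs r (abs c)^-1 (geometric_inverse Q c s).
Proof.
have ac : 0 < abs c by rewrite (abs_gt0 habs).
have -> : (abs c)^-1 = abs c^-1 * 1 by rewrite mulr1 absV.
rewrite /geometric_inverse -mul_mpolyC.
apply: (gauss_leM habs (ltW r0)); first exact: gauss_leC.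
apply: (@gauss_le_sum _ _ _ _ habs r 1 'I_s (index_enum 'I_s) predT) => [||k _];
  [exact: ltW|exact: ler01|].
apply: gauss_leW (gauss_leXn k gauss_le_geometric_ratio).
by rewrite exprn_ile1 // ltW.
Qed.

Lemma geometric_inverse_eval w s : (forall i, abs (w i) <= r) ->
  abs (Q.@[w] * (geometric_inverse Q c s).@[w] - 1) <= rho ^+ s.
Proof.
move=> hw; rewrite -mevalM geometric_inverseE // mevalB meval1 addrAC subrr add0r absN //.
exact: (gauss_le_eval habs (ltW r0) (gauss_leXn s gauss_le_geometric_ratio)).
Qed.

Lemma abs_eval_eq w : (forall i, abs (w i) <= r) -> abs Q.@[w] = abs c.
Proof.
move=> hw; apply: abs_eq_of_lt => //.
rewrite -[X in abs (_ - X)](mevalC w) -mevalB.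
apply: le_lt_trans (gauss_le_eval habs (ltW r0) hQ hw) _.
by rewrite gtr_pMl // (abs_gt0 habs).
Qed.

Lemma geometric_inverse_cvg w : (forall i, abs (w i) <= r) ->
  abs_cvg abs (fun s => (geometric_inverse Q c s).@[w]) (Q.@[w])^-1.
Proof.
move=> hw; have Qw := abs_eval_eq hw.
have Q0 : Q.@[w] != 0 by rewrite -(abs_eq0 habs) Qw (abs_eq0 habs).
have h : abs_cvg abs (fun s => Q.@[w] * (geometric_inverse Q c s).@[w] - 1) 0.
  apply: (@cvg_squeeze0 _ _ _ _ (fun s => rho ^+ s)) => [e e0|].
    exact: expr_eventually_lt.
  by exists 0%N => s _; apply: geometric_inverse_eval.
have := cvgM habs (cvg_cst habs Q.@[w]^-1) (cvgD habs h (cvg_cst habs 1)).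
rewrite add0r mulr1; apply: cvg_eventually; exists 0%N => s _.
by rewrite subrK mulKf.
Qed.

End GeometricInverse.

Lemma analytic_at_invB b i j : b 0 i != b 0 j ->
  analytic_at abs (fun z => (z 0 i - z 0 j)^-1) b.
Proof.
move=> hij; pose c := b 0 i - b 0 j; have c0 : c != 0 by rewrite subr_eq0.
have ac : 0 < abs c by rewrite (abs_gt0 habs).
(* At this radius ['X_i - 'X_j] has Gauss norm at most half of [abs c], which gives the geometric
   series the ratio 1/2. *)
pose r := abs c / 2%:R; have r0 : 0 < r by rewrite divr_gt0 // ltr0n.
pose Q : {mpoly K[n]} := 'X_i - 'X_j + c%:MP.
have hQ : gauss_le abs r (2%:R^-1 * abs c) (Q - c%:MP).
  rewrite addrK mulrC; apply: (gauss_leB habs (ltW r0)); apply: gauss_leX => //; exact: ltW.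
have h0 : 0 <= 2%:R^-1 :> R by rewrite invr_ge0 ler0n.
have h1 : 2%:R^-1 < 1 :> R by lra.
apply: (@approx_analytic (abs c)^-1 r b _ (geometric_inverse Q c)) => //; split=> [s|z hz].
  exact: gauss_le_geometric_inverse hQ s.
have -> : z 0 i - z 0 j = Q.@[offset b z].
  by rewrite mevalD mevalB !mevalXU mevalC /offset /c; ring.
exact: geometric_inverse_cvg hQ _ _.
Qed.

End AnalyticFunctions.

(** * Completeness of finite extensions *)

Section FiniteExtension.
Variables (R : realType) (F : fieldType) (absF : F -> R).
Variables (K : fieldExtType F) (abs : K -> R).
Hypotheses (habsF : nonarch_abs absF) (habs : nonarch_abs abs).
Hypothesis abs_alg : forall x : F, abs x%:A = absF x.
Hypothesis habsF_complete : abs_complete absF.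

Lemma absZ c v : abs (c *: v) = absF c * abs v.
Proof. by rewrite -[v in LHS]mul1r scalerAl absM // abs_alg. Qed.

Definition complete_space (V : {vspace K}) : Prop :=
  forall u, (forall k, u k \in V) -> abs_cauchy abs u ->
    exists2 l, l \in V & abs_cvg abs u l.

(** A complete subspace is closed: at distance zero, a sequence in [V] would converge to [v], and
    its limit would lie in [V]. *)
Lemma complete_space_dist V v : complete_space V -> v \notin V ->
  exists2 d, 0 < d & forall x, x \in V -> d <= abs (v - x).
Proof.
move=> hV hv.
have [//|hn] := pselect (exists2 d, 0 < d & forall x, x \in V -> d <= abs (v - x)).
have half1 : 2%:R^-1 < 1 :> R by lra.
have half0 : 0 <= 2%:R^-1 :> R by rewrite invr_ge0 ler0n.
have hx k : exists x, x \in V /\ abs (v - x) < 2%:R^-1 ^+ k.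
  have [//|hk] := pselect (exists x, x \in V /\ abs (v - x) < 2%:R^-1 ^+ k).
  case: hn; exists (2%:R^-1 ^+ k) => [|x xV]; first by rewrite exprn_gt0 // invr_gt0 ltr0n.
  by rewrite leNgt; apply/negP => hlt; apply: hk; exists x.
have [x xP] := choice hx.
have hcvg : abs_cvg abs x v.
  move=> e e0; apply: eventuallyW (expr_eventually_lt half0 half1 e0) => k.
  by rewrite abs_distC //; apply: lt_trans; case: (xP k).
have [l lV hl] := hV x (fun k => proj1 (xP k)) (cvg_cauchy habs hcvg).
by case/negP: hv; rewrite (cvg_unique habs hcvg hl).
Qed.

(** Induction on the spanning list. The coefficient along a new vector [v] is controlled by the
    distance from [v] to the span of the others, positive because that span is complete. Hence this
    coefficient is Cauchy in [F], and so is the component left in the span. *)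
Lemma complete_span X : complete_space <<X>>%VS.
Proof.
elim: X => [|v X IH] u hu hc.
  exists 0; first exact: mem0v.
  apply: cvg_eventually (cvg_cst habs 0); exists 0%N => k _.
  by move: (hu k); rewrite span_nil memv0 => /eqP ->.
have [vX|vX] := boolP (v \in <<X>>%VS).
  have E : <<v :: X>>%VS = <<X>>%VS by rewrite span_cons; apply/addv_idPr; rewrite -memvE.
  by rewrite E in hu *; apply: IH.
have [d d0 hd] := complete_space_dist IH vX.
have hcx k : exists cx : F * K, cx.2 \in <<X>>%VS /\ u k = cx.1 *: v + cx.2.
  have := hu k; rewrite span_cons => /memv_addP[y /vlineP[c ->] [x xX ->]].
  by exists (c, x).
have [cx cxP] := choice hcx.
pose c k := (cx k).1; pose x k := (cx k).2.
have hE k : u k = c k *: v + x k by case: (cxP k).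
have xX k : x k \in <<X>>%VS by case: (cxP k).
have bound j k : absF (c j - c k) * d <= abs (u j - u k).
  have [->|ne] := eqVneq (c j) (c k).
    by rewrite subrr abs0 // mul0r (abs_ge0 habs).
  have ne' : c j - c k != 0 by rewrite subr_eq0.
  have -> : u j - u k = (c j - c k) *: (v - (c j - c k)^-1 *: (x k - x j)).
    by rewrite scalerBr scalerA divff // scale1r !hE scalerBl; ring.
  rewrite absZ ler_wpM2l ?(abs_ge0 habsF) //; apply: hd.
  by rewrite memvZ // rpredB.
have hcc : abs_cauchy absF c.
  move=> e e0; have [N hN] := hc (e * d) (mulr_gt0 e0 d0).
  exists N => j k hj hk; have := le_lt_trans (bound j k) (hN j k hj hk).
  by rewrite ltr_pM2r.
have [c0 hc0] := habsF_complete hcc.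
have hcv : abs_cvg abs (fun k => c k *: v) (c0 *: v).
  have h : abs_cvg abs (fun k => (c k)%:A) c0%:A.
    by move=> e /hc0[N hN]; exists N => k /hN; rewrite -scalerBl abs_alg.
  apply: (@cvg_eventually _ _ _ (fun k => (c k)%:A * v)).
    by exists 0%N => k _; rewrite mulr_algl.
  by rewrite -(mulr_algl c0); apply: (cvgM habs) h (cvg_cst habs v).
have hxc : abs_cauchy abs x.
  move=> e e0; have [N1 hN1] := hc e e0; have [N2 hN2] := cvg_cauchy habs hcv e0.
  exists (maxn N1 N2) => j k; rewrite !geq_max => /andP[j1 j2] /andP[k1 k2].
  have -> : x j - x k = (u j - u k) - (c j *: v - c k *: v) by rewrite !hE; ring.
  by apply: absD_lt; rewrite ?absN // ?hN1 ?hN2.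
have [l lX hl] := IH x xX hxc.
exists (c0 *: v + l); first by rewrite span_cons memv_add // memvZ // memv_line.
by apply: cvg_eventually (cvgD habs hcv hl); exists 0%N => k _; rewrite hE.
Qed.

Lemma ext_complete : abs_complete abs.
Proof.
move=> u hu; have := @complete_span (vbasis {:K}) u.
rewrite (span_basis (vbasisP _)) => /(_ (fun k => memvf _) hu)[l _ hl].
by exists l.
Qed.

End FiniteExtension.

(** * The p-adic norm *)

Section PadicNorm.
Variables (R : realType) (p : nat) (Qp : fieldType) (absQp : Qp -> R).
Variables (m : nat) (K : fieldExtType Qp) (abs : K -> R).
Hypothesis hp : prime p.
Hypothesis hQp : is_Qp p absQp.
Hypothesis hK : is_unramified_ext absQp m abs.

Lemma abs_natr k : abs k%:R = padic_norm R p k%:R.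
Proof.
case: hK => _ _ halg _; case: hQp => _ hrat _ _.
have -> : k%:R = k%:R%:A :> K by rewrite scaler_nat.
by rewrite halg -hrat ratr_nat.
Qed.

Lemma padic_norm_nat k : (0 < k)%N -> padic_norm R p k%:R = (p%:R ^+ logn p k)^-1.
Proof.
move=> k0; rewrite /padic_norm pnatr_eq0 eqn0Ngt k0 /=.
by rewrite -[k%:R]/(k%:Z%:~R) denq_int numq_int /= logn1 expr0 div1r.
Qed.

Lemma abs_prime : abs p%:R = p%:R^-1.
Proof.
rewrite abs_natr padic_norm_nat ?prime_gt0 // logn_prime // eqxx expr1.
by [].
Qed.

Lemma abs_coprime k : ~~ (p %| k)%N -> abs k%:R = 1.
Proof.
move=> hk; have k0 : (0 < k)%N by case: k hk; rewrite ?dvdn0.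
by rewrite abs_natr padic_norm_nat // lognE hp k0 (negPf hk) expr0 invr1.
Qed.

Lemma abs_prime_lt1 : abs p%:R < 1.
Proof. by rewrite abs_prime invf_lt1 ?ltr0n ?ltr1n ?prime_gt1 ?prime_gt0. Qed.

Lemma ext_natS_neq0 k : k.+1%:R != 0 :> K.
Proof.
case: hK => _ habs _ _; rewrite -(abs_eq0 habs) abs_natr padic_norm_nat //.
by rewrite invr_eq0 expf_neq0 // pnatr_eq0 -lt0n prime_gt0.
Qed.

Lemma ext_nondiscrete e : 0 < e -> exists2 h : K, h != 0 & abs h < e.
Proof.
case: hK => _ habs _ _ e0.
have [N hN] := expr_eventually_lt (abs_ge0 habs _) abs_prime_lt1 e0.
exists (p%:R ^+ N); last by rewrite absX // hN.
rewrite expf_neq0 //; have := ext_natS_neq0 p.-1; by rewrite prednK ?prime_gt0.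
Qed.

Lemma unramified_complete : abs_complete abs.
Proof.
case: hK => _ habs halg _; case: hQp => habsQ _ _ hc.
exact: (ext_complete habsQ habs halg hc).
Qed.

End PadicNorm.

(** * Hasse-Witt matrices modulo the maximal ideal *)

Section SubringPredicate.
Variable S : comNzRingType.

(** An abstract integrality condition. It is applied to the elements of [K] of norm at most 1, to
    multivariate polynomials of Gauss norm at most 1, and to polynomials in [t] with coefficients of
    either kind. *)
Definition subring_pred (I : S -> Prop) : Prop :=
  [/\ I 1, forall x y, I x -> I y -> I (x - y) & forall x y, I x -> I y -> I (x * y)].

Variable I : S -> Prop.
Hypothesis hI : subring_pred I.

Lemma subring_pred0 : I 0.
Proof. by case: hI => h1 hB _; rewrite -(subrr 1); apply: hB. Qed.

Lemma subring_predN x : I x -> I (- x).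
Proof. by move=> hx; case: hI => _ hB _; rewrite -(sub0r x); apply: hB => //;
  apply: subring_pred0. Qed.

Lemma subring_predD x y : I x -> I y -> I (x + y).
Proof.
move=> hx hy; case: hI => _ hB _.
by rewrite -(opprK y); apply: hB => //; apply: subring_predN.
Qed.

Lemma subring_predM x y : I x -> I y -> I (x * y).
Proof. by case: hI => _ _; apply. Qed.

Lemma subring_pred_sum (T : Type) (s : seq T) (P : pred T) (F : T -> S) :
  (forall i, P i -> I (F i)) -> I (\sum_(i <- s | P i) F i).
Proof. by move=> h; elim/big_ind: _ => //; [apply: subring_pred0 | apply: subring_predD]. Qed.

Lemma subring_pred_prod (T : Type) (s : seq T) (P : pred T) (F : T -> S) :
  (forall i, P i -> I (F i)) -> I (\prod_(i <- s | P i) F i).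
Proof. by move=> h; elim/big_ind: _ => //; [case: hI | apply: subring_predM]. Qed.

Lemma subring_predX x k : I x -> I (x ^+ k).
Proof.
move=> hx; elim: k => [|k IH]; first by rewrite expr0; case: hI.
by rewrite exprS; apply: subring_predM.
Qed.

Lemma subring_pred_nat k : I k%:R.
Proof.
elim: k => [|k IH]; first exact: subring_pred0.
by rewrite -natr1; apply: subring_predD => //; case: hI.
Qed.

Lemma subring_pred_sign x k : I x -> I ((-1) ^+ k * x).
Proof.
move=> hx; apply: subring_predM => //; apply/subring_predX/subring_predN.
by case: hI.
Qed.

Definition mx_pred m1 m2 (A : 'M[S]_(m1, m2)) : Prop := forall i j, I (A i j).

Lemma subring_pred_mulmx m1 m2 m3 (A : 'M[S]_(m1, m2)) (B : 'M[S]_(m2, m3)) :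
  mx_pred A -> mx_pred B -> mx_pred (A *m B).
Proof. by move=> hA hB i j; rewrite mxE; apply: subring_pred_sum => k _;
  apply: subring_predM. Qed.

Lemma subring_pred_det k (A : 'M[S]_k) : mx_pred A -> I (\det A).
Proof.
move=> hA; apply: subring_pred_sum => s _; apply: subring_pred_sign.
exact: subring_pred_prod.
Qed.

Lemma subring_pred_adj k (A : 'M[S]_k) : mx_pred A -> mx_pred (\adj A).
Proof.
move=> hA i j; rewrite mxE; apply: subring_pred_sign; apply: subring_pred_det => a b.
by rewrite !mxE.
Qed.

Definition coef_pred (J : S -> Prop) (P : {poly S}) : Prop := forall k, J P`_k.

Section Ideal.
Variable J : S -> Prop.

Definition ideal_pred : Prop :=
  [/\ J 0, forall x y, J x -> J y -> J (x + y) & forall x y, I x -> J y -> J (x * y)].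

Hypothesis hJ : ideal_pred.

Lemma ideal_predN x : J x -> J (- x).
Proof.
move=> hx; rewrite -mulN1r; case: hJ => _ _; apply=> //.
by apply: subring_predN; case: hI.
Qed.

Lemma ideal_pred_sum (T : Type) (s : seq T) (P : pred T) (F : T -> S) :
  (forall i, P i -> J (F i)) -> J (\sum_(i <- s | P i) F i).
Proof. by case: hJ => h0 hD _ h; elim/big_ind: _. Qed.

Lemma ideal_pred_trans y x z : J (x - y) -> J (y - z) -> J (x - z).
Proof. by case: hJ => _ hD _ h1 h2; rewrite -(subrK y x) -addrA; apply: hD. Qed.

Lemma ideal_predMB x y x' y' : I x -> I y' ->
  J (x - x') -> J (y - y') -> J (x * y - x' * y').
Proof.
case: hJ => _ hD hM hx hy' h h'.
have -> : x * y - x' * y' = x * (y - y') + y' * (x - x') by ring.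
by apply: hD; apply: hM.
Qed.

Lemma ideal_pred_prodB (T : Type) (s : seq T) (P : pred T) (F G : T -> S) :
  (forall i, I (F i)) -> (forall i, I (G i)) -> (forall i, J (F i - G i)) ->
  J (\prod_(i <- s | P i) F i - \prod_(i <- s | P i) G i).
Proof.
move=> hF hG h; elim: s => [|i s IH]; first by rewrite !big_nil subrr; case: hJ.
rewrite !big_cons; case: ifP => // _; apply: ideal_predMB => //.
exact: subring_pred_prod.
Qed.

Lemma ideal_predXB x y k : I x -> I y -> J (x - y) -> J (x ^+ k - y ^+ k).
Proof.
move=> hx hy h; rewrite -(card_ord k) -!prodr_const.
exact: ideal_pred_prodB.
Qed.

Lemma ideal_pred_detB k (A B : 'M[S]_k) : mx_pred A -> mx_pred B ->
  (forall i j, J (A i j - B i j)) -> J (\det A - \det B).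
Proof.
move=> hA hB h; rewrite /determinant -sumrB; apply: ideal_pred_sum => s _.
rewrite -mulrBr; case: hJ => _ _; apply; last exact: ideal_pred_prodB.
by apply/subring_predX/subring_predN; case: hI.
Qed.

Variable p : nat.
Hypotheses (hp : prime p) (Jp : J p%:R).

(** Additivity of Frobenius modulo an ideal containing [p]: the inner binomial coefficients are
    multiples of [p]. *)
Lemma ideal_pred_exprD x y : I x -> I y -> J ((x + y) ^+ p - (x ^+ p + y ^+ p)).
Proof.
move=> hx hy; have [h0 hD hM] := hJ.
have p0 := prime_gt0 hp; case: p p0 hp Jp => // q _ hq Jq.
rewrite exprDn big_ord_recl big_ord_recr /= subn0 subnn !bin0 binn !expr0 mulr1 mul1r.
rewrite !mulr1n opprD addrACA subrr add0r addrK.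
apply: ideal_pred_sum => i _; rewrite /bump leq0n add1n.
have /dvdnP[c ->] : (q.+1 %| 'C(q.+1, i.+1))%N.
  by apply: prime_dvd_bin => //; rewrite /= ltnS ltn_ord.
rewrite mulrnA -mulr_natr; apply: hM.
  by rewrite -mulr_natr; apply: subring_predM; [apply: subring_predM;
    apply: subring_predX | apply: subring_pred_nat].
by [].
Qed.

Lemma ideal_pred_sumX (T : Type) (s : seq T) (F : T -> S) :
  (forall i, I (F i)) -> J ((\sum_(i <- s) F i) ^+ p - \sum_(i <- s) F i ^+ p).
Proof.
move=> hF; elim: s => [|i s IH].
  by rewrite !big_nil expr0n eqn0Ngt prime_gt0 // subrr; case: hJ.
rewrite !big_cons; apply: ideal_pred_trans (ideal_pred_exprD (hF i) _) _.
  exact: subring_pred_sum.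
by rewrite opprD addrACA subrr add0r.
Qed.

Lemma ideal_pred_sumXX (T : Type) (s : seq T) (F : T -> S) k :
  (forall i, I (F i)) ->
  J ((\sum_(i <- s) F i) ^+ (p ^ k) - \sum_(i <- s) F i ^+ (p ^ k)).
Proof.
move=> hF; elim: k => [|k IH].
  by rewrite expn0 expr1 subrr; case: hJ.
rewrite expnSr exprM.
apply: ideal_pred_trans (ideal_predXB p _ _ IH) _.
- by apply: subring_predX; apply: subring_pred_sum.
- by apply: subring_pred_sum => i _; apply: subring_predX.
rewrite [X in _ - X](eq_bigr (fun i => (F i ^+ (p ^ k)) ^+ p)) => [|i _];
  last by rewrite exprM.
by apply: ideal_pred_sumX => i; apply: subring_predX.
Qed.

(** Frobenius applied to the Leibniz expansion of the determinant; since [p] is odd, the signs of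
    the permutations are their own powers. *)
Lemma ideal_pred_detX k (A : 'M[S]_k) e : mx_pred A -> odd p ->
  J (\det (map_mx (fun x => x ^+ (p ^ e)) A) - \det A ^+ (p ^ e)).
Proof.
move=> hA op; rewrite -opprB; apply: ideal_predN.
have -> : \det (map_mx (fun x => x ^+ (p ^ e)) A) =
    \sum_(s : 'S_k) ((-1) ^+ s * \prod_i A i (s i)) ^+ (p ^ e).
  apply: eq_bigr => s _; rewrite exprMn -prodrXl; congr (_ * _).
    by rewrite exprAC; congr (_ ^+ _); rewrite -signr_odd oddX op orbT.
  by apply: eq_bigr => i _; rewrite mxE.
apply: ideal_pred_sumXX => s; apply: subring_pred_sign.
exact: subring_pred_prod.
Qed.

End Ideal.

End SubringPredicate.

Lemma coef_subring_pred (S : comNzRingType) (I : S -> Prop) :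
  subring_pred I -> subring_pred (coef_pred I).
Proof.
move=> hI; split=> [k|P Q hP hQ k|P Q hP hQ k].
- by rewrite coef1; case: (k == 0%N); [case: hI | apply: subring_pred0].
- by rewrite coefB; case: hI => _ hB _; apply: hB.
- by rewrite coefM; apply: subring_pred_sum => // i _; apply: subring_predM.
Qed.

Lemma coef_ideal_pred (S : comNzRingType) (I J : S -> Prop) :
  ideal_pred I J -> ideal_pred (coef_pred I) (coef_pred J).
Proof.
move=> [h0 hD hM]; split=> [k|P Q hP hQ k|P Q hP hQ k].
- by rewrite coef0.
- by rewrite coefD; apply: hD.
- by rewrite coefM; elim/big_ind: _ => // i _; apply: hM.
Qed.

Lemma sum_ord_support (V : nmodType) a b (G : nat -> V) :
  (forall j, (a <= j)%N -> G j = 0) -> (forall j, (b <= j)%N -> G j = 0) ->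
  \sum_(j < a) G j = \sum_(j < b) G j.
Proof.
move=> ha hb; wlog le_ab : a b ha hb / (a <= b)%N.
  by move=> H; case: (leqP a b) => [|/ltnW] h; [apply: H | rewrite (H b a)].
rewrite (big_ord_widen b G le_ab) big_mkcond; apply: eq_bigr => j _.
by case: ltnP => // /ha.
Qed.

(** * Arithmetic of the exponent (p^s - 1)/2 *)

Section OddPrime.
Variables p g : nat.
Hypotheses (g_gt0 : (0 < g)%N) (hp : prime p) (hpg : (2 * g + 1 < p)%N).

Lemma odd_p : odd p.
Proof. by case: (even_prime hp) => // p2; move: hpg; rewrite p2 addn1 !ltnS;
  case: (g) g_gt0 => // k _; rewrite mulnS. Qed.

(** On exponents, the factorization of [Phi] at level [s + 1] into [Phi] at level [s] and the
    [p^s]-th power of [Phi] at level 1. *)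
Lemma half_powS s : ((p ^ s.+1 - 1) %/ 2 = (p ^ s - 1) %/ 2 + (p - 1) %/ 2 * p ^ s)%N.
Proof.
have hs : odd (p ^ s) by rewrite oddX odd_p orbT.
rewrite expnS; move: (p ^ s)%N hs => q hq.
have Eq : q = (2 * q./2 + 1)%N by rewrite -{1}[q]odd_double_half hq -muln2; lia.
have Ep : p = (2 * p./2 + 1)%N by rewrite -{1}[p]odd_double_half odd_p -muln2; lia.
move: q./2 p./2 Eq Ep => b a -> ->.
have -> : ((2 * a + 1) * (2 * b + 1) - 1 = 2 * (2 * a * b + a + b))%N by nia.
by rewrite !addnK !mulKn //; nia.
Qed.

Lemma powp_gt s : (0 < s)%N -> (2 * g + 1 < p ^ s)%N.
Proof. by move=> s0; apply: leq_trans hpg _;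
  rewrite -[X in (X <= _)%N]expn1 (leq_pexp2l (prime_gt0 hp)). Qed.

Lemma half_powE s : (2 * ((p ^ s - 1) %/ 2) + 1 = p ^ s)%N.
Proof.
have hs : odd (p ^ s) by rewrite oddX odd_p orbT.
rewrite -{2}[(p ^ s)%N]odd_double_half hs.
have -> : (p ^ s - 1 = 2 * (p ^ s)./2)%N.
  by rewrite -{1}[(p ^ s)%N]odd_double_half hs -muln2; lia.
by rewrite mulKn // -muln2; lia.
Qed.

Lemma half_pow_gt0 s : (0 < s)%N -> (0 < ((p ^ s - 1) %/ 2))%N.
Proof. by move=> /powp_gt; have := half_powE s; lia. Qed.

End OddPrime.

(** * Integrality and unit determinant of the Hasse-Witt matrices *)

Section HasseWitt.
Variables (R : realType) (K : fieldType) (abs : K -> R) (p g : nat).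
Hypotheses (g_gt0 : (0 < g)%N) (habs : nonarch_abs abs) (hp : prime p) (hpg : (2 * g + 1 <
  p)%N).
Hypotheses (abs_p : abs p%:R < 1).
Local Notation n := (2 * g + 1)%N.
Implicit Types (z : 'rV[K]_n).

Definition abs_le1 (x : K) : Prop := abs x <= 1.
Definition abs_lt1 (x : K) : Prop := abs x < 1.

Lemma abs_le1_subring : subring_pred abs_le1.
Proof.
rewrite /subring_pred /abs_le1; split=> [|x y|x y]; first by rewrite abs1.
  exact: absB_le.
by move=> hx hy; rewrite absM // mulr_ile1 ?abs_ge0.
Qed.

Lemma abs_lt1_ideal : ideal_pred abs_le1 abs_lt1.
Proof.
rewrite /ideal_pred /abs_le1 /abs_lt1; split=> [|x y|x y]; first by rewrite abs0.
  exact: absD_lt.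
move=> hx hy; rewrite absM //; apply: le_lt_trans hy.
by rewrite ler_piMl ?abs_ge0.
Qed.

Lemma Phi_coef0 s z k : (n * ((p ^ s - 1) %/ 2) < k)%N -> (Phi p s z)`_k = 0.
Proof.
move=> hk; apply: nth_default; apply: leq_trans hk.
apply: leq_trans (size_poly_exp_leq _ _) _; rewrite ltnS leq_mul2r.
by rewrite size_prod_XsubC -[index_enum _]enumT size_enum_ord leqnn orbT.
Qed.

Lemma Phi_le1 s z : (forall i, abs (z 0 i) <= 1) -> coef_pred abs_le1 (Phi p s z).
Proof.
move=> hz; have hS := coef_subring_pred abs_le1_subring.
apply: (subring_predX hS); apply: (subring_pred_prod hS) => i _ k.
rewrite coefB coefX coefC; apply: absB_le => //.
  by case: (k == 1%N); rewrite ?abs1 ?abs0.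
by case: (k == 0%N); rewrite ?abs0.
Qed.

Lemma hasse_witt_le1 s z : (forall i, abs (z 0 i) <= 1) ->
  mx_pred abs_le1 (hasse_witt p s z).
Proof. by move=> hz u v; rewrite mxE; apply: Phi_le1. Qed.

(** With [F := Phi p 1 z], [Phi p s.+1 z = Phi p s z * F ^+ (p ^ s)], and modulo
    the maximal ideal [F ^+ (p ^ s)] only involves powers of ['X^(p ^ s)]. *)
Lemma hasse_witt_step s z u v : (0 < s)%N -> (forall i, abs (z 0 i) <= 1) ->
  abs_lt1 (hasse_witt p s.+1 z u v -
    (hasse_witt p s z *m map_mx (fun x => x ^+ (p ^ s)) (hasse_witt p 1 z)) u v).
Proof.
move=> s0 hz; have hS := coef_subring_pred abs_le1_subring.
have hJ := coef_ideal_pred abs_lt1_ideal.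
have hps := powp_gt hp hpg s0; have p0 := prime_gt0 hp.
set F := Phi p 1 z.
have hPhi : Phi p s.+1 z = Phi p s z * F ^+ (p ^ s).
  by rewrite /F /Phi (half_powS g_gt0 hp hpg) exprD exprM expn1.
pose G : {poly K} := \sum_(j < size F) (F`_j *: 'X^j) ^+ (p ^ s).
have hFG : coef_pred abs_lt1 (F ^+ (p ^ s) - G).
  rewrite -{1}[F]coefK poly_def; apply: (ideal_pred_sumXX hS hJ hp) => [k|j k].
    by rewrite -polyC_natr coefC; case: (k == 0%N); rewrite /abs_lt1 ?abs0.
  rewrite coefZ coefXn; apply: (subring_predM abs_le1_subring); first exact: Phi_le1.
  exact: (subring_pred_nat abs_le1_subring).
rewrite [in X in abs_lt1 (X - _)]mxE hPhi -[F ^+ _](subrK G) mulrDr coefD -addrA.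
set N := (_ - u.+1)%N.
have -> : (Phi p s z * G)`_N =
   (hasse_witt p s z *m map_mx (fun x => x ^+ (p ^ s)) (hasse_witt p 1 z)) u v.
  (* The contribution to [t^N] of the term of [G] in [t^(j p^s)], zero when that power exceeds
     [N]. *)
  pose T j := F`_j ^+ (p ^ s) *
     (if (N < j * p ^ s)%N then 0 else (Phi p s z)`_(N - j * p ^ s)).
  have -> : (Phi p s z * G)`_N = \sum_(j < size F) T j.
    rewrite mulr_sumr coef_sum; apply: eq_bigr => j _.
    by rewrite exprZn -exprM -scalerAr coefZ coefMXn.
  rewrite (@sum_ord_support _ _ (p * v.+1) T) => [|j hj|j hj]; first last.
  - rewrite /T; case: ltnP => [|]; rewrite ?mulr0 // leqNgt => /negP[].
    rewrite /N expnSr; have := leq_mul2r (p ^ s) (p * v.+1) j; rewrite hj orbT; nia.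
  - by rewrite /T nth_default // expr0n eqn0Ngt expn_gt0 p0 mul0r.
  rewrite (reindex_inj rev_ord_inj) /=.
  (* The substitution [j = p(v+1) - (w+1)] turns the coefficient of [F] into the entry [(w, v)] of
     the Hasse-Witt matrix of level 1. *)
  pose T' w := T (p * v.+1 - w.+1)%N.
  rewrite -/(\sum_(w < p * v.+1) T' w).
  have hN w : (w < p * v.+1)%N ->
      T' w = F`_(p * v.+1 - w.+1) ^+ (p ^ s) * (Phi p s z)`_(p ^ s * w.+1 - u.+1).
    move=> hw; rewrite /T' /T; congr (_ * _).
    have hu := ltn_ord u.
    have E : (N = (p * v.+1 - w.+1) * p ^ s + (p ^ s * w.+1 - u.+1))%N.
      by rewrite /N expnSr; nia.
    by rewrite E ltnNge leq_addr /= addKn.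
  pose T2 w := F`_(p * v.+1 - w.+1) ^+ (p ^ s) * (Phi p s z)`_(p ^ s * w.+1 - u.+1).
  rewrite (eq_bigr (fun w : 'I_(p * v.+1) => T2 w)) => [|w _]; last exact: hN.
  (* Degree bound: [p^s (g+1) - g] already exceeds [(2g+1)(p^s - 1)/2], the degree of [Phi], so
     exactly the range of a product of [g x g] matrices is left. *)
  have hT2 w : (g <= w)%N -> T2 w = 0.
    move=> hw; rewrite /T2 (Phi_coef0 (s := s)) ?mulr0 //.
    have hu := ltn_ord u;
      have hdiv : ((p ^ s - 1) %/ 2 * 2 <= p ^ s - 1)%N := leq_trunc_div _ _.
    by nia.
  have hgp : (g <= p * v.+1)%N by nia.
  rewrite (@sum_ord_support _ _ g T2) => [|w hw|]; [| by apply: hT2; lia | exact: hT2].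
  rewrite mxE; apply: eq_bigr => w _; rewrite /T2 !mxE expn1 mulrC; congr (_ * _ ^+ _).
have [_ _ hM] := hJ.
by rewrite subrr addr0; apply: hM => //; apply: Phi_le1.
Qed.

(** Modulo the maximal ideal, the determinant at level [s + 1] is the one at level [s] times the
    [p^s]-th power of the one at level 1; units stay units under such a congruence. *)
Lemma abs_det_hasse_witt s z : (0 < s)%N -> D_KZ abs p z ->
  abs (\det (hasse_witt p s z)) = 1.
Proof.
move=> s0 [hz hdet]; case: s s0 => // s _; elim: s => // s IH.
have hI := abs_le1_subring; have hJ := abs_lt1_ideal.
pose B : 'M[K]_g := map_mx (fun x => x ^+ (p ^ s.+1)) (hasse_witt p 1 z).
have hB : mx_pred abs_le1 B.
  by move=> i j; rewrite mxE; apply: (subring_predX hI); apply: hasse_witt_le1.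
have h1 : abs_lt1 (\det (hasse_witt p s.+2 z) - \det (hasse_witt p s.+1 z *m B)).
  apply: (ideal_pred_detB hI hJ) => [||u v]; first exact: hasse_witt_le1.
    by apply: (subring_pred_mulmx hI) => //; apply: hasse_witt_le1.
  exact: hasse_witt_step.
have h2 : abs_lt1 (\det B - \det (hasse_witt p 1 z) ^+ (p ^ s.+1)).
  by apply: (ideal_pred_detX hI hJ hp) => //;
    [apply: hasse_witt_le1 | apply: odd_p g_gt0 hp hpg].
have hdB : abs (\det B) = 1.
  have hX : abs (\det (hasse_witt p 1 z) ^+ (p ^ s.+1)) = 1 by rewrite absX // hdet expr1n.
  by rewrite -hX; apply: (abs_eq_of_lt habs); rewrite hX.
have hAB : abs (\det (hasse_witt p s.+1 z *m B)) = 1.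
  by rewrite det_mulmx absM // IH hdB mulr1.
by rewrite -hAB; apply: (abs_eq_of_lt habs); rewrite hAB.
Qed.

End HasseWitt.

(** * Products of powers of linear factors *)

Section RootProducts.
Variables (S : comNzRingType) (n : nat).
Implicit Types (x : 'I_n -> S) (a : 'I_n -> nat) (e : nat).

Definition root_prod x a : {poly S} := \prod_k ('X - (x k)%:P) ^+ a k.

Lemma root_prod_ext x a a' : a =1 a' -> root_prod x a = root_prod x a'.
Proof. by move=> h; apply: eq_bigr => k _; rewrite h. Qed.

Lemma root_prodS x a j :
  root_prod x (fun k => a k + (k == j))%N = ('X - (x j)%:P) * root_prod x a.
Proof.
rewrite /root_prod (bigD1 j) //= [in RHS](bigD1 j) //= eqxx addn1 exprS -mulrA.
by congr (_ * (_ * _)); apply: eq_bigr => k /negPf ->; rewrite addn0.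
Qed.

Lemma root_prod_const x e : root_prod x (fun=> e) = (\prod_k ('X - (x k)%:P)) ^+ e.
Proof. by rewrite -prodrXl. Qed.

(** An arbitrary [D] with the Leibniz rule serves two uses: [d/dt], and [d/dz_i] acting on the
    coefficients of the powers of [t]. *)
Lemma root_prod_leibniz (D : {poly S} -> {poly S}) x a :
  (forall P Q, D (P * Q) = D P * Q + P * D Q) ->
  D (root_prod x a) =
    \sum_k (D ('X - (x k)%:P) *+ a k) * root_prod x (fun l => a l - (l == k))%N.
Proof.
move=> hD; have D1 : D 1 = 0.
  by have := hD 1 1; rewrite !mulr1 mul1r => /eqP; rewrite -subr_eq subrr => /eqP.
have DX P k : D (P ^+ k) = (D P *+ k) * P ^+ k.-1.
  elim: k => [|k IH]; first by rewrite expr0 D1 mulr0n mul0r.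
  rewrite exprS hD IH /=; case: k {IH} => [|k] /=; first by rewrite expr0 !mulr0n; ring.
  by rewrite mulrA [P * _]mulrC -mulrA -exprS -mulrDl -mulrS.
have Dprod (r : seq 'I_n) (F : 'I_n -> {poly S}) : uniq r ->
    D (\prod_(k <- r) F k) = \sum_(k <- r) D (F k) * \prod_(l <- r | l != k) F l.
  elim: r => [|k r IH] /=; first by rewrite !big_nil.
  case/andP=> kr ur; rewrite !big_cons hD IH // eqxx /=; congr (_ * _ + _).
    rewrite big_seq_cond [RHS]big_seq_cond; apply: eq_bigl => l; rewrite andbT.
    by case: eqP => [->|_]; rewrite ?andbT // (negPf kr).
  rewrite mulr_sumr !big_seq; apply: eq_bigr => l lr.
  rewrite big_cons; case: eqP => [E|_]; first by rewrite E lr in kr.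
  by rewrite mulrCA.
rewrite /root_prod Dprod ?index_enum_uniq //; apply: eq_bigr => k _.
rewrite DX -mulrA; congr (_ * _); rewrite [RHS](bigD1 k) //= eqxx subn1; congr (_ * _).
by apply: eq_bigr => l /negPf ->; rewrite subn0.
Qed.

(** If [Phi] is the product of the [(t - x_k)^e], then [psi] is [Phi / (t - x_j)] and [theta] is
    [Phi / ((t - x_i)(t - x_j))], obtained by lowering exponents. For [e > 0] the subtraction is
    truncated only in [theta x 1 i i], which [deriv_psi] multiplies by [e - 1 = 0]. *)
Definition psi x e j := root_prod x (fun k => e - (k == j))%N.
Definition theta x e i j := root_prod x (fun k => e - (k == i) - (k == j))%N.

Lemma mul_psi x e j : (0 < e)%N -> ('X - (x j)%:P) * psi x e j = root_prod x (fun=> e).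
Proof.
move=> e0; rewrite -root_prodS; apply: root_prod_ext => k.
by case: (k == j); rewrite ?subn0 ?addn0 ?subnK.
Qed.

Lemma thetaC x e i j : theta x e i j = theta x e j i.
Proof. by apply: root_prod_ext => k; rewrite subnAC. Qed.

Lemma mul_theta x e i j : (0 < e)%N -> i != j ->
  ('X - (x j)%:P) * theta x e i j = psi x e i.
Proof.
move=> e0 ij; rewrite -root_prodS; apply: root_prod_ext => k.
by case: (eqVneq k j) => [->|_]; rewrite ?subn0 ?addn0 // eq_sym (negPf ij) subn0 subnK.
Qed.

(** Partial fractions of [1/(t - x_i) - 1/(t - x_j)], multiplied by [Phi]. It cancels the
    denominators of the KZ operators. *)
Lemma psiB x e i j : (0 < e)%N -> i != j ->
  psi x e i - psi x e j = (x i - x j)%:P * theta x e i j.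
Proof.
move=> e0 ij; rewrite -{1}(mul_theta x e0 ij).
by rewrite -(@mul_theta x e j i) // 1?eq_sym // thetaC polyCB; ring.
Qed.

Lemma deriv_psi x e i :
  (psi x e i)^`() = \sum_j (theta x e i j) *+ (e - (j == i)).
Proof.
rewrite (root_prod_leibniz _ _ (@derivM _)); apply: eq_bigr => j _.
by rewrite derivXsubC mulrnAl mul1r.
Qed.

Lemma deriv_root_prod x e :
  (root_prod x (fun=> e))^`() = (\sum_j psi x e j) *+ e.
Proof.
rewrite (root_prod_leibniz _ _ (@derivM _)) -sumrMnl; apply: eq_bigr => j _.
by rewrite derivXsubC mulrnAl mul1r.
Qed.

(** The quotient of [t^K - x_j^K] by [t - x_j] is a geometric sum, and the factor [t - x_j]
    completes [psi x e j] to the full product; summing over [j] produces the power sums. *)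
Lemma sum_psi_powers x e K : (0 < e)%N ->
  \sum_j (x j ^+ K)%:P * psi x e j =
  'X^K * (\sum_j psi x e j) -
    \sum_(a < K) (\sum_j x j ^+ (K.-1 - a)) *: ('X^a * root_prod x (fun=> e)).
Proof.
move=> e0; rewrite mulr_sumr.
have -> : \sum_(a < K) (\sum_j x j ^+ (K.-1 - a)) *: ('X^a * root_prod x (fun=> e)) =
   \sum_j ('X - (x j)%:P) * (\sum_(a < K) (x j ^+ (K.-1 - a))%:P * 'X^a) * psi x e j.
  transitivity (\sum_j \sum_(a < K) (x j ^+ (K.-1 - a)) *: ('X^a * root_prod x (fun=> e))).
    by rewrite exchange_big; apply: eq_bigr => a _; rewrite scaler_suml.
  apply: eq_bigr => j _; rewrite mulrAC mul_psi // mulr_sumr.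
  by apply: eq_bigr => a _; rewrite -mul_polyC; ring.
rewrite -sumrB; apply: eq_bigr => j _; rewrite polyC_exp.
have := subrXX (x j)%:P 'X K.
rewrite (eq_bigr (fun a : 'I_K => (x j ^+ (K.-1 - a))%:P * 'X^a)) => [h|a _];
  last by rewrite polyC_exp.
set s := \sum_(_ < _) _ in h *.
have -> : (x j)%:P ^+ K = ((x j)%:P - 'X) * s + 'X^K by rewrite -h subrK.
by ring.
Qed.

End RootProducts.

Lemma map_root_prod (S S' : comNzRingType) (f : {rmorphism S -> S'}) n (x : 'I_n -> S) a :
  map_poly f (root_prod x a) = root_prod (f \o x) a.
Proof.
rewrite rmorph_prod; apply: eq_bigr => k _.
by rewrite rmorphXn /= map_polyXsubC.
Qed.

(** * The KZ equations modulo powers of p *)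

Section VandermondeRelation.
Variables (S : comNzRingType) (g n : nat).
Implicit Types (x : 'I_n -> S).

(** The exponents start at 1: a row of exponent 0 would add up the entries of a column of
    [hypergeom], and this sum vanishes modulo [p^s]. *)
Definition vandermonde x : 'M[S]_(g, n) := \matrix_(k, j) x j ^+ k.+1.

(** The term [2(k+1)] is what [Phi' / e] contributes modulo [p^s]; the power sums are those of
    [sum_psi_powers]. *)
Definition power_sum_mx x : 'M[S]_g :=
  \matrix_(k, a) ((2 * k.+1)%:R *+ (k == a) - (\sum_j x j ^+ (k - a)) *+ (a <= k)%N).

End VandermondeRelation.

Section PointwiseKZ.
Variables (R : realType) (K : fieldType) (abs : K -> R) (p g : nat).
Hypotheses (g_gt0 : (0 < g)%N) (habs : nonarch_abs abs).
Hypotheses (hp : prime p) (hpg : (2 * g + 1 < p)%N).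
Hypothesis abs_nat_coprime : forall k, ~~ (p %| k)%N -> abs k%:R = 1.
Hypothesis natS_neq0 : forall k, k.+1%:R != 0 :> K.
Local Notation n := (2 * g + 1)%N.
Local Notation half_pow s := ((p ^ s - 1) %/ 2)%N.
Implicit Types (z : 'rV[K]_n).

Definition coords z : 'I_n -> K := fun k => z 0 k.

Lemma abs_half_pow s : (0 < s)%N -> abs (half_pow s)%:R = 1.
Proof.
move=> s0; apply: abs_nat_coprime; apply/negP => h.
have : (p %| 2 * half_pow s + 1)%N by rewrite (half_powE g_gt0 hp hpg) dvdn_exp.
by rewrite dvdn_addr ?dvdn_mull // dvdn1 => /eqP E; have := prime_gt1 hp; rewrite E.
Qed.

Lemma abs_two : abs 2%:R = 1.
Proof. by apply: abs_nat_coprime; rewrite gtnNdvd //; lia. Qed.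

Lemma natr_neq0 k : (0 < k)%N -> k%:R != 0 :> K.
Proof. by case: k. Qed.

Lemma root_prod_le1 z a : (forall i, abs (z 0 i) <= 1) ->
  coef_pred (abs_le1 abs) (root_prod (coords z) a).
Proof.
move=> hz; have hS := coef_subring_pred (abs_le1_subring habs).
apply: (subring_pred_prod hS) => i _; apply: (subring_predX hS) => k.
rewrite coefB coefX coefC; apply: absB_le => //.
  by case: (k == 1%N); rewrite ?abs1 ?abs0.
by case: (k == 0%N); rewrite ?abs0 //; apply: hz.
Qed.

Lemma Phi_root_prod s z : Phi p s z = root_prod (coords z) (fun=> half_pow s).
Proof. by rewrite root_prod_const. Qed.

Lemma hypergeom_psi s z j l : (0 < s)%N ->
  hypergeom p s z j l = (psi (coords z) (half_pow s) j)`_(l.+1 * p ^ s - 1).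
Proof.
move=> s0; rewrite mxE Phi_root_prod -(@mul_psi _ _ _ _ j (half_pow_gt0 g_gt0 hp hpg s0)).
by rewrite mulKp // polyXsubC_eq0.
Qed.

Lemma hypergeom_le1 s z j l : (0 < s)%N -> (forall i, abs (z 0 i) <= 1) ->
  abs (hypergeom p s z j l) <= 1.
Proof. by move=> s0 hz; rewrite hypergeom_psi //; apply: root_prod_le1. Qed.

(** The sum of the [psi] is [Phi' / e], so the exponent [(l+1)p^s - (k+1)] of a differentiated
    monomial enters divided by [e]. As [p^s = 2e + 1], this quotient is [2(k+1) + p^s (l-k)/e],
    which separates the main term from the error [E]. *)
Lemma vandermonde_hypergeom s z (E := \matrix_(k < g, l < g)
    ((half_pow s)%:R^-1 * (l%:R - k%:R) * hasse_witt p s z k l)) : (0 < s)%N ->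
  vandermonde g (coords z) *m hypergeom p s z =
    power_sum_mx g (coords z) *m hasse_witt p s z + (p ^ s)%:R *: E.
Proof.
move=> s0; have e0 := half_pow_gt0 g_gt0 hp hpg s0; have hps := powp_gt hp hpg s0.
apply/matrixP => k l; set e := half_pow s; have ene := natr_neq0 e0.
have hk := ltn_ord k; have hl := ltn_ord l.
set x := coords z; set N := (l.+1 * p ^ s - 1)%N.
have psE : (p ^ s)%:R = 2%:R * e%:R + 1 :> K by rewrite -[in LHS](half_powE g_gt0 hp hpg)
  natrD natrM.
have hAu (u : 'I_g) : hasse_witt p s z u l = (root_prod x (fun=> e))`_(N - u).
  by rewrite mxE Phi_root_prod; congr (_`_ _); rewrite /N; lia.
have hV : (vandermonde g x *m hypergeom p s z) k l =
    (\sum_j (x j ^+ k.+1)%:P * psi x e j)`_N.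
  rewrite coef_sum mxE; apply: eq_bigr => j _.
  by rewrite coefCM hypergeom_psi // mxE.
pose W := \sum_(u < g) ((\sum_j x j ^+ (k - u)) *+ (u <= k)%N) * hasse_witt p s z u l.
have hT : (power_sum_mx g x *m hasse_witt p s z) k l =
    (2 * k.+1)%:R * hasse_witt p s z k l - W.
  rewrite mxE /W (eq_bigr (fun u => (2 * k.+1)%:R *+ (k == u) * hasse_witt p s z u l -
     ((\sum_j x j ^+ (k - u)) *+ (u <= k)%N) * hasse_witt p s z u l)) => [|u _]; last first.
    by rewrite mxE mulrBl.
  rewrite sumrB (bigD1 k) //= eqxx big1 ?addr0 // => u /negPf uk.
  by rewrite eq_sym uk mul0r.
have hW : (\sum_(a < k.+1) (\sum_j x j ^+ (k.+1.-1 - a)) *: ('X^a * root_prod x (fun=>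
  e)))`_N = W.
  rewrite coef_sum /W.
  pose G a := (\sum_j x j ^+ (k - a)) * (root_prod x (fun=> e))`_(N - a) *+ (a <= k)%N.
  transitivity (\sum_(a < k.+1) G a).
    apply: eq_bigr => a _; rewrite coefZ coefXnM /G (leq_ord a) mulr1n.
    by rewrite ltnNge (_ : (a <= N)%N) //; have := ltn_ord a; rewrite /N; nia.
  rewrite (@sum_ord_support _ _ g G) => [|a ha|a ha]; first last.
  - by rewrite /G leqNgt (leq_trans hk ha) mulr0n.
  - by rewrite /G leqNgt ha mulr0n.
  by apply: eq_bigr => u _; rewrite /G hAu mulrnAl.
have hder : e%:R * (\sum_j psi x e j)`_(N - k.+1) =
   (l.+1 * p ^ s - k.+1)%:R * hasse_witt p s z k l.
  have := congr1 (fun P : {poly K} => P`_(N - k.+1)) (deriv_root_prod x e).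
  rewrite /= coef_deriv coefMn -[_ *+ e]mulr_natl -[_ *+ _.+1]mulr_natl hAu => <-.
  by congr (_%:R * _`_ _); rewrite /N; nia.
rewrite hV [RHS]mxE hT sum_psi_powers // coefB hW coefXnM.
rewrite ltnNge (_ : (k.+1 <= N)%N) /=; last by rewrite /N; nia.
rewrite [(_ *: E) k l]mxE [E k l]mxE -/e; apply: (mulfI ene);
  rewrite mulrBr hder natrB ?natrM; last by nia.
rewrite psE.
by rewrite -!natr1; field.
Qed.

Lemma det_power_sum_mx z :
  \det (power_sum_mx g (coords z)) = \prod_(k < g) ((2 * k.+1)%:R - n%:R).
Proof.
rewrite det_trig; last first.
  apply/is_trig_mxP => i j ij; rewrite mxE leqNgt ij mulr0n subr0.
  by rewrite -val_eqE (ltn_eqF ij) mulr0n.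
apply: eq_bigr => k _; rewrite mxE eqxx leqnn subnn !mulr1n; congr (_ - _).
rewrite (eq_bigr (fun=> 1)) => [|j _]; last by rewrite expr0.
by rewrite sumr_const card_ord.
Qed.

(** The diagonal entries come from the integers [2(k+1) - n], negative for [k < g], and nonzero
    integers do not vanish in [K]. *)
Lemma power_sum_mx_unit z : power_sum_mx g (coords z) \in unitmx.
Proof.
rewrite unitmxE unitfE det_power_sum_mx; apply/prodf_neq0 => k _.
rewrite -opprB oppr_eq0 -natrB.
  by apply: natr_neq0; have := ltn_ord k; lia.
by have := ltn_ord k; lia.
Qed.

Lemma mul_Omega m2 (i j r : 'I_n) (M : 'M[K]_(n, m2)) l :
  (Omega K i j *m M) r l = ((r == i)%:R - (r == j)%:R) * (M j l - M i l).
Proof.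
have hd (a b : 'I_n) : (delta_mx a b *m M) r l = (r == a)%:R * M b l.
  rewrite mxE (bigD1 b) //= big1 ?addr0; first by rewrite mxE eqxx andbT.
  by move=> c /negPf cb; rewrite mxE cb andbF mul0r.
have hB (A B : 'M[K]_n) : ((A - B) *m M) r l = (A *m M) r l - (B *m M) r l.
  by rewrite mulmxBl !mxE.
have hD (A B : 'M[K]_n) : ((A + B) *m M) r l = (A *m M) r l + (B *m M) r l.
  by rewrite mulmxDl !mxE.
by rewrite /Omega !hB hD !hd; ring.
Qed.

Lemma mul_KZ_H m2 i z (M : 'M[K]_(n, m2)) r l :
  (KZ_H i z *m M) r l = 2%:R^-1 * \sum_(j < n | j != i)
     (z 0 i - z 0 j)^-1 * (((r == i)%:R - (r == j)%:R) * (M j l - M i l)).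
Proof.
rewrite /KZ_H -scalemxAl mxE mulmx_suml summxE; congr (_ * _).
by apply: eq_bigr => j _; rewrite -scalemxAl mxE mul_Omega.
Qed.

(** Rows other than [i] record the discrepancy in [-e = 1/2 - p^s/2]; row [i] has in addition the
    factor [l+1] left when [d/dt] brings down the exponent [(l+1)p^s]. *)
Definition KZ_error i s z : 'M[K]_(n, g) := \matrix_(r, l)
  let N := (l.+1 * p ^ s - 1)%N in
  if r == i then
    2%:R^-1 * \sum_(j < n | j != i) (theta (coords z) (half_pow s) i j)`_N
      - l.+1%:R * (psi (coords z) (half_pow s) i)`_N.+1
  else - (2%:R^-1 * (theta (coords z) (half_pow s) r i)`_N).

(** [D] is the [z_i]-derivative of [hypergeom], by [mderiv_lift_hypergeom]. Its row [i] involves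
    only [theta i i], which is traded for the [theta i j] through the [t]-derivative of [psi], whose
    coefficient at [t^N] is a multiple of [p^s]. *)
Lemma KZ_hypergeom i s z (D := \matrix_(r < n, l < g)
    (- ((theta (coords z) (half_pow s) r i)`_(l.+1 * p ^ s - 1)
         *+ (half_pow s - (r == i))))) :
  (0 < s)%N -> off_diagonals z ->
  D = KZ_H i z *m hypergeom p s z + (p ^ s)%:R *: KZ_error i s z.
Proof.
move=> s0 hz; have e0 := half_pow_gt0 g_gt0 hp hpg s0; have hps := powp_gt hp hpg s0.
have psE : (p ^ s)%:R = 2%:R * (half_pow s)%:R + 1 :> K by rewrite -[in LHS](half_powE
  g_gt0 hp hpg) natrD natrM.
have h2 : 2%:R != 0 :> K := natS_neq0 1.
apply/matrixP => r l;
  rewrite [LHS]mxE [RHS]mxE mul_KZ_H [((p ^ s)%:R *: KZ_error i s z) r l]mxE [KZ_error i s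
    z r l]mxE; set N := (l.+1 * p ^ s - 1)%N.
set e := half_pow s in e0 psE *; set x := coords z.
have hzz (j k : 'I_n) : j != k -> z 0 j - z 0 k != 0 by move=> jk; rewrite subr_eq0; apply: hz.
have hdiff (j k : 'I_n) : j != k -> hypergeom p s z j l - hypergeom p s z k l =
    (z 0 j - z 0 k) * (theta x e j k)`_N.
  by move=> jk; rewrite !hypergeom_psi // -coefB psiB // coefCM.
have [->|ri] := eqVneq r i; last first.
  rewrite subn0 (bigD1 r) //= eqxx (hdiff r i) // big1 => [|j /andP[ji jr]]; last first.
    by rewrite eq_sym (negPf jr) subrr mul0r mulr0.
  have := hzz i r; rewrite eq_sym => /(_ ri) hir.
  by rewrite psE -[_ *+ e]mulr_natr -[true%:R]/(1 : K); field; apply/andP.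
rewrite (eq_bigr (fun j => - (theta x e i j)`_N)) => [|j ji]; last first.
  rewrite -[true%:R]/(1 : K) [i == j]eq_sym (negPf ji) subr0 mul1r -[hypergeom p s z j l -
    _]opprB hdiff 1?eq_sym //.
  by rewrite mulrN mulKf // hzz // eq_sym.
have hd : (psi x e i)`_N.+1 * (l.+1%:R * (p ^ s)%:R) =
    (theta x e i i)`_N *+ (e - 1) + (\sum_(j < n | j != i) (theta x e i j)`_N) *+ e.
  have := congr1 (fun P : {poly K} => P`_N) (deriv_psi x e i).
  rewrite /= coef_deriv coef_sum (bigD1 i) //= eqxx coefMn -sumrMnl -natrM mulr_natr.
  rewrite (_ : N.+1 = l.+1 * p ^ s)%N; last by rewrite /N; nia.
  move=> ->; congr (_ + _); apply: eq_bigr => j /negPf ->.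
  by rewrite subn0 coefMn.
rewrite sumrN /= -[(e - true)%N]/(e - 1)%N; move: hd; set A := (theta x e i i)`_N;
  set B := \sum_(_ < _ | _) _.
set C := _`_N.+1; rewrite -[A *+ _]mulr_natr -[B *+ e]mulr_natr => hd.
have -> : - (A * (e - 1)%:R) = B * e%:R - C * (l.+1%:R * (p ^ s)%:R).
  by rewrite hd; ring.
by rewrite psE; field.
Qed.

Lemma KZ_error_le1 i s z : (0 < s)%N -> (forall k, abs (z 0 k) <= 1) ->
  mx_bounded abs 1 (KZ_error i s z).
Proof.
move=> s0 hz r l; rewrite mxE /=; have hS := abs_le1_subring habs.
have hinv2 : abs_le1 abs 2%:R^-1 by rewrite /abs_le1 absV // abs_two invr1.
have hth j k N : abs_le1 abs (theta (coords z) (half_pow s) j k)`_N by apply: root_prod_le1.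
case: ifP => _.
  apply: (subring_predD hS); last first.
    apply: (subring_predN hS); apply: (subring_predM hS); first exact: (subring_pred_nat hS).
    exact: root_prod_le1.
  by apply: (subring_predM hS) => //; apply: (subring_pred_sum hS).
by apply: (subring_predN hS); apply: (subring_predM hS).
Qed.


End PointwiseKZ.

(** * The limit matrix and its covariant derivative *)

Section HypergeometricDistribution.
Variables (R : realType) (K : fieldType) (abs : K -> R) (p g : nat).
Hypotheses (g_gt0 : (0 < g)%N) (habs : nonarch_abs abs).
Hypotheses (hp : prime p) (hpg : (2 * g + 1 < p)%N).
Hypothesis abs_p_lt1 : abs p%:R < 1.
Hypothesis abs_nat_coprime : forall k, ~~ (p %| k)%N -> abs k%:R = 1.
Hypothesis natS_neq0 : forall k, k.+1%:R != 0 :> K.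
Hypothesis abs_nondiscrete : forall e : R, 0 < e -> exists2 h : K, h != 0 & abs h < e.
Hypothesis habs_complete : abs_complete abs.
Local Notation n := (2 * g + 1)%N.
Local Notation half_pow s := ((p ^ s - 1) %/ 2)%N.
Implicit Types (b z : 'rV[K]_n).

Local Lemma abs_p_cvg0 : abs_cvg abs (fun s => (p ^ s.+1)%:R) 0.
Proof.
move=> e e0; have [N hN] := cvg_expr habs abs_p_lt1 e0.
by exists N => s hs; rewrite natrX; apply: hN; apply: leqW.
Qed.

Lemma gauss_le1_subring (r : R) : 0 <= r ->
  subring_pred (fun Q : {mpoly K[n]} => gauss_le abs r 1 Q).
Proof.
move=> r0; split=> [|x y|x y hx hy]; last by rewrite -[1]mulr1; apply: gauss_leM.
  by rewrite -mpolyC1 -(abs1 habs); apply: gauss_leC.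
exact: gauss_leB.
Qed.

(** Without the constant term every monomial has degree at least 1, hence weight at most [r]. For
    the determinants of the lifts this gives a closeness to their value at [b] independent of
    [s]. *)
Lemma gauss_le_sub_const (Q : {mpoly K[n]}) (r : R) : 0 <= r -> r <= 1 ->
  gauss_le abs 1 1 Q -> gauss_le abs r r (Q - (Q.@[fun=> 0])%:MP).
Proof.
move=> r0 r1 hQ m; rewrite mcoeffB mcoeffC meval_at0; case: (eqVneq m 0%MM) => [->|m0].
  by rewrite mulr1 subrr abs0 // mul0r.
rewrite mulr0 subr0; have := hQ m; rewrite expr1n mulr1 => h.
have hr : r ^+ mdeg m <= r.
  have := m0; rewrite -mdeg_eq0; case: (mdeg m) => // d _.
  by rewrite exprS ler_piMr // exprn_ile1.
by apply: le_trans hr; rewrite ler_piMl // exprn_ge0.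
Qed.

(** * Polynomial lifts around a point of [D_KZ] *)

Section Lift.
Variable b : 'rV[K]_n.

Definition lift_coords : 'I_n -> {mpoly K[n]} := fun i => 'X_i + (b 0 i)%:MP.

Definition lift_hasse_witt s : 'M[{mpoly K[n]}]_g :=
  \matrix_(u, v) (root_prod lift_coords (fun=> half_pow s))`_(p ^ s * v.+1 - u.+1).

Definition lift_hypergeom s : 'M[{mpoly K[n]}]_(n, g) :=
  \matrix_(j, l) (psi lift_coords (half_pow s) j)`_(l.+1 * p ^ s - 1).

Lemma eval_lift_root_prod a k z :
  ((root_prod lift_coords a)`_k).@[offset b z] = (root_prod (coords z) a)`_k.
Proof.
rewrite -coef_map map_root_prod; congr ((polyseq _)`_k); apply: eq_bigr => i _.
by rewrite /= mevalD mevalXU mevalC /offset subrK.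
Qed.

Lemma eval_lift_hasse_witt s z :
  map_mx (meval (offset b z)) (lift_hasse_witt s) = hasse_witt p s z.
Proof.
apply/matrixP => u v.
by rewrite !mxE Phi_root_prod eval_lift_root_prod.
Qed.

Lemma eval_lift_hypergeom s z : (0 < s)%N ->
  map_mx (meval (offset b z)) (lift_hypergeom s) = hypergeom p s z.
Proof.
move=> s0; apply/matrixP => u v.
by rewrite (hypergeom_psi g_gt0 hp hpg) // 2!mxE eval_lift_root_prod.
Qed.

(** Cramer's rule, with the inverse of the determinant replaced by a geometric sum around its value
    at [b]. The level [s] is also the number of terms, so that the truncation error tends to 0. *)
Definition lift_inverse s : 'M[{mpoly K[n]}]_g :=
  geometric_inverse (\det (lift_hasse_witt s)) (\det (hasse_witt p s b)) s
    *: \adj (lift_hasse_witt s).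

Definition lift_Ical s : 'M[{mpoly K[n]}]_(n, g) :=
  lift_hypergeom s.+1 *m lift_inverse s.+1.

Hypothesis b_D : D_KZ abs p b.

Lemma offset_center : offset b b =1 fun=> 0.
Proof. by move=> i; rewrite /offset subrr. Qed.

Lemma gauss_le_lift_root_prod (r : R) a : 0 <= r -> r <= 1 ->
  coef_pred (fun Q => gauss_le abs r 1 Q) (root_prod lift_coords a).
Proof.
move=> r0 r1; have hI := gauss_le1_subring r0.
have hS := coef_subring_pred hI.
apply: (subring_pred_prod hS) => i _; apply: (subring_predX hS) => k.
rewrite coefB coefX coefC; case: hI => h1 hB _; apply: hB.
  by case: (k == 1%N) => //; apply: subring_pred0 (gauss_le1_subring r0).
case: (k == 0%N); last exact: subring_pred0 (gauss_le1_subring r0).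
apply: (gauss_leD habs r0); first by apply: gauss_leW r1 _; apply: gauss_leX.
by apply: gauss_leW (gauss_leC habs _ _); case: b_D.
Qed.

Section PositiveLevel.
Variable s : nat.
Hypothesis s_gt0 : (0 < s)%N.
Let c := \det (hasse_witt p s b).
Let Q := \det (lift_hasse_witt s).

Lemma abs_lift_center : abs c = 1.
Proof. exact: (abs_det_hasse_witt g_gt0 habs hp hpg abs_p_lt1). Qed.

Lemma lift_center_neq0 : c != 0.
Proof. by rewrite -(abs_eq0 habs) abs_lift_center oner_eq0. Qed.

Lemma eval_lift_det z : Q.@[offset b z] = \det (hasse_witt p s z).
Proof. by rewrite -eval_lift_hasse_witt det_map_mx. Qed.

Lemma gauss_le_lift_hasse_witt (r : R) : 0 <= r -> r <= 1 ->
  mx_pred (fun Q => gauss_le abs r 1 Q) (lift_hasse_witt s).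
Proof. by move=> r0 r1 u v; rewrite mxE; apply: gauss_le_lift_root_prod. Qed.

Lemma gauss_le_lift_det (r : R) : 0 <= r -> r <= 1 ->
  gauss_le abs r (r * abs c) (Q - c%:MP).
Proof.
move=> r0 r1; rewrite abs_lift_center mulr1.
have -> : c = Q.@[fun=> 0] by rewrite -(meval_eq _ offset_center) eval_lift_det.
apply: gauss_le_sub_const => //.
exact: (subring_pred_det (gauss_le1_subring ler01) (gauss_le_lift_hasse_witt ler01 _)).
Qed.

Lemma gauss_le_lift_inverse (r : R) : 0 < r -> r < 1 ->
  mx_pred (fun Q => gauss_le abs r 1 Q) (lift_inverse s).
Proof.
move=> r0 r1 i j; have hI := gauss_le1_subring (ltW r0); rewrite mxE.
apply: (subring_predM hI); last first.
  exact: (subring_pred_adj hI (gauss_le_lift_hasse_witt (ltW r0) (ltW r1))).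
rewrite -[1]invr1 -abs_lift_center.
exact: (gauss_le_geometric_inverse habs r0 lift_center_neq0 (ltW r0) r1
  (gauss_le_lift_det (ltW r0) (ltW r1))).
Qed.

Lemma eval_lift_inverse z :
  map_mx (meval (offset b z)) (lift_inverse s) =
    (geometric_inverse Q c s).@[offset b z] *: \adj (hasse_witt p s z).
Proof. by rewrite /lift_inverse map_mxZ map_mx_adj eval_lift_hasse_witt. Qed.

(** At the center the determinant equals [c], the ratio of the geometric series is 0, and for
    [s > 0] the truncated inverse is exact. *)
Lemma lift_inverse_center :
  map_mx (meval (offset b b)) (lift_inverse s) *m hasse_witt p s b = 1%:M.
Proof.
rewrite eval_lift_inverse -scalemxAl mul_adj_mx -/c scale_scalar_mx mulrC.
have hc : Q.@[offset b b] = c by rewrite eval_lift_det.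
rewrite -{1}hc -mevalM geometric_inverseE ?lift_center_neq0 //.
rewrite mevalB meval1 rmorphXn /= mevalB mevalZ meval1 hc mulVf ?lift_center_neq0 //.
by rewrite subrr expr0n eqn0Ngt s_gt0 subr0.
Qed.

End PositiveLevel.

(** On the polydisc the determinant of level 1 stays within [r < 1] of its value at [b], which is a
    unit. *)
Lemma polydisc_D_KZ z (r : R) : 0 < r -> r < 1 -> polydisc abs b r z -> D_KZ abs p z.
Proof.
move=> r0 r1 hz; case: (b_D) => hb hdet; split=> [i|].
  rewrite -(subrK (b 0 i) (z 0 i)); apply: absD_le => //.
  exact: le_trans (hz i) (ltW r1).
rewrite -eval_lift_det -hdet.
exact: (abs_eval_eq habs r0 (lift_center_neq0 _) r1 (gauss_le_lift_det _ (ltW r0) (ltW r1))).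
Qed.

End Lift.

Variable Ical : 'rV[K]_n -> 'M[K]_(n, g).
Hypothesis hI : is_limit_matrix abs p Ical.

(** The geometric sum differs from the inverse determinant by at most [2^-s], and the matrices it
    multiplies are integral, so the lifts have the same limit as [J_s]. Any radius below 1 would
    give the Gauss bound 1. *)
Lemma Ical_approx b i l : D_KZ abs p b ->
  poly_approx abs 1 2%:R^-1 b (fun z => Ical z i l) (fun s => lift_Ical b s i l).
Proof.
move=> bD; have r0 : 0 < 2%:R^-1 :> R by rewrite invr_gt0 ltr0n.
have r1 : 2%:R^-1 < 1 :> R by lra.
split=> [s | z hz].
  have hS := gauss_le1_subring (ltW r0).
  apply: (subring_pred_mulmx hS); last exact: gauss_le_lift_inverse.
  by move=> u v; rewrite mxE; apply: gauss_le_lift_root_prod => //; apply: ltW.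
have zD := polydisc_D_KZ bD r0 r1 hz.
pose d s := \det (hasse_witt p s z).
have hd s : (0 < s)%N -> abs (d s) = 1.
  by move=> s0; apply: (abs_det_hasse_witt g_gt0 habs hp hpg abs_p_lt1).
pose q s := (geometric_inverse (\det (lift_hasse_witt b s)) (\det (hasse_witt p s b))
  s).@[offset b z].
pose M s := hypergeom p s z *m \adj (hasse_witt p s z).
have hM s : (0 < s)%N -> abs (M s i l) <= 1.
  move=> s0; have hS := abs_le1_subring habs; have [hz1 _] := zD.
  apply: (subring_pred_mulmx hS) => [u v|].
    exact: (hypergeom_le1 g_gt0 habs hp hpg).
  by apply: (subring_pred_adj hS); apply: hasse_witt_le1.
have hcvg : abs_cvg abs (fun s => (q s.+1 - (d s.+1)^-1) * M s.+1 i l) 0.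
  apply: (@cvg0_bounded _ _ _ habs _ _ 1); first by exists 0%N => s _; apply: hM.
  apply: (cvg_squeeze0 (c := fun s => 2%:R^-1 ^+ s.+1)) => [e e0|].
    have [N hN] := expr_eventually_lt (ltW r0) r1 e0.
    by exists N => s hs; apply: hN; apply: leqW.
  exists 0%N => s _; have ds : d s.+1 != 0 by rewrite -(abs_eq0 habs) hd ?oner_eq0.
  have -> : q s.+1 - (d s.+1)^-1 = (d s.+1)^-1 * (d s.+1 * q s.+1 - 1) by field.
  rewrite absM // absV // hd // invr1 mul1r /d -(eval_lift_det b).
  have hG := gauss_le_lift_det bD (ltn0Sn s) (ltW r0) (ltW r1).
  exact: (geometric_inverse_eval habs r0 (lift_center_neq0 bD (ltn0Sn s)) hG s.+1 hz).
have hf : abs_cvg abs (fun s => (hypergeom p s.+1 z *m invmx (hasse_witt p s.+1 z)) i l)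
  (Ical z i l).
  by move=> e /hI[N hN]; exists N => s hs; apply: hN => //; apply: leqW.
have := cvgD habs hcvg hf; rewrite add0r; apply: cvg_eventually; exists 0%N => s _.
have hu : hasse_witt p s.+1 z \in unitmx.
  by rewrite unitmxE unitfE -(abs_eq0 habs) (hd s.+1) ?oner_eq0.
have -> : (lift_Ical b s i l).@[offset b z] = map_mx (meval (offset b z)) (lift_Ical b s) i l.
  by rewrite [RHS]mxE.
rewrite map_mxM eval_lift_hypergeom // eval_lift_inverse //.
rewrite /invmx hu -!scalemxAr -/(M s.+1) -/(d s.+1) -/(q s.+1).
have hZ (c : K) : (c *: M s.+1) i l = c * M s.+1 i l by rewrite mxE.
by rewrite !hZ; ring.
Qed.

Lemma Ical_analytic b i l : D_KZ abs p b -> analytic_at abs (fun z => Ical z i l) b.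
Proof.
by move=> bD; apply: approx_analytic (Ical_approx i l bD); rewrite ?invr_gt0 ?ltr0n.
Qed.

(** The derivation in [z_i], acting on the coefficients of the powers of [t], sends [t - z_k] to
    [-1] if [k = i] and to 0 otherwise: one term of the Leibniz expansion remains. *)
Lemma mderiv_lift_hypergeom b i s :
  map_mx (meval (offset b b)) (map_mx (mderiv i) (lift_hypergeom b s)) =
  \matrix_(r < n, l < g)
    (- ((theta (coords b) (half_pow s) r i)`_(l.+1 * p ^ s - 1)
         *+ (half_pow s - (r == i)))).
Proof.
pose D (P : {poly {mpoly K[n]}}) := map_poly (mderiv i) P.
have coefD' P k : (D P)`_k = (P`_k)^`M(i) by rewrite coef_map_id0 ?mderiv0.
have hD P Q : D (P * Q) = D P * Q + P * D Q.
  apply/polyP => k; rewrite coefD' coefD !coefM (raddf_sum (mderiv i)) -big_split.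
  by apply: eq_bigr => j _; rewrite !coefD' /= mderivM.
have hXc c : D ('X - c%:P) = - (c^`M(i))%:P.
  apply/polyP => m.
  rewrite (coefD' ('X - c%:P) m) (coefB 'X) coefX coefN.
  rewrite [in LHS]coefC.
  rewrite [in RHS]coefC mderivB.
  have -> : ((m == 1%N)%:R : {mpoly K[n]})^`M(i) = 0.
    by case: (m == 1%N); rewrite ?mderiv0 // -mpolyC1 mderivC.
  by case: (m == 0%N); rewrite ?mderiv0 sub0r.
have hX k : D ('X - (lift_coords b k)%:P) = - (k == i)%:R%:P.
  rewrite hXc mderivD mderivC addr0 mderivX mnm1E; congr (- _%:P).
  case: eqP => [->|_]; last by rewrite scale0r.
  rewrite scale1r (_ : (U_(i) - U_(i))%MM = 0%MM) ?mpolyX0 //.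
  by apply/mnmP => j; rewrite mnmBE subnn mnm0E.
apply/matrixP => r l; rewrite [RHS]mxE 3!mxE; set N := (_ - 1)%N.
rewrite -coefD' (root_prod_leibniz _ _ hD) (bigD1 i) //= big1 => [|k /negPf ki]; last first.
  by rewrite hX ki polyC0 oppr0 mul0rn mul0r.
rewrite addr0 hX eqxx polyC1 mulNrn mulNr mulrnAl mul1r coefN coefMn.
rewrite mevalN mevalMn eval_lift_root_prod.
by rewrite [i == r]eq_sym.
Qed.

(** * Passage to the limit in the KZ equations *)

Definition mx_ubounded m1 m2 (A : nat -> 'M[K]_(m1, m2)) : Prop :=
  exists2 c : R, 0 <= c & forall s, mx_bounded abs c (A s).

Local Lemma mx_uboundedM m1 m2 m3 (A : nat -> 'M[K]_(m1, m2)) (B : nat -> 'M[K]_(m2, m3)) :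
  mx_ubounded A -> mx_ubounded B -> mx_ubounded (fun s => A s *m B s).
Proof.
move=> [c c0 hA] [d d0 hB]; exists (c * d) => [|s]; first exact: mulr_ge0.
exact: mx_boundedM.
Qed.

Local Lemma mx_uboundedB m1 m2 (A B : nat -> 'M[K]_(m1, m2)) :
  mx_ubounded A -> mx_ubounded B -> mx_ubounded (fun s => A s - B s).
Proof.
move=> [c c0 hA] [d d0 hB]; exists (Num.max c d) => [|s i j].
  by rewrite le_max c0.
by rewrite !mxE; apply: absB_le => //; rewrite le_max ?hA ?hB ?orbT.
Qed.

Local Lemma mx_ubounded_cst m1 m2 (A : 'M[K]_(m1, m2)) : mx_ubounded (fun=> A).
Proof.
exists (\sum_i \sum_j abs (A i j)) => [|_ i j].
  by apply: sumr_ge0 => i _; apply: sumr_ge0 => j _; apply: abs_ge0.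
rewrite (bigD1 i) //= (bigD1 j) //= -addrA lerDl addr_ge0 //.
  by apply: sumr_ge0 => k _; apply: abs_ge0.
by apply: sumr_ge0 => k _; apply: sumr_ge0 => k' _; apply: abs_ge0.
Qed.

(** The column space of [Ical b] is the image of [Ical b *m invmx T *m V], so
    membership of the derivative in it is a closed condition, which survives
    the limit; the connection matrix itself need not be approximated. *)
Lemma nabla_Ical_in_span b i (dI : 'M[K]_(n, g)) :
  D_KZ abs p b -> off_diagonals b ->
  (forall k l, is_partial abs i (fun z => Ical z k l) b (dI k l)) ->
  let v := dI - KZ_H i b *m Ical b in
  v = Ical b *m (invmx (power_sum_mx g (coords b)) *m vandermonde g (coords b) *m v).
Proof.
move=> bD bO hdI v; have [hb1 _] := bD.
have r0 : 0 < 2%:R^-1 :> R by rewrite invr_gt0 ltr0n.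
have r1 : 2%:R^-1 < 1 :> R by lra.
have hr := polydisc_center habs b (ltW r0).
set T := power_sum_mx g (coords b); set V := vandermonde g (coords b).
set H := KZ_H i b.
have Tu : T \in unitmx by apply: (power_sum_mx_unit g_gt0 hp hpg natS_neq0).
pose ev m1 m2 (M : 'M[{mpoly K[n]}]_(m1, m2)) := map_mx (meval (offset b b)) M.
pose J s := hypergeom p s.+1 b; pose A s := hasse_witt p s.+1 b.
pose G s := ev _ _ (lift_inverse b s.+1).
pose dG s := ev _ _ (map_mx (mderiv i) (lift_inverse b s.+1)).
pose dP s := ev _ _ (map_mx (mderiv i) (lift_Ical b s)).
pose E s := KZ_error p i s.+1 b.
pose E' s := \matrix_(k < g, l < g)
  ((half_pow s.+1)%:R^-1 * (l%:R - k%:R) * hasse_witt p s.+1 b k l).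
have hP : mx_cvg abs (fun s => J s *m G s) (Ical b).
  move=> k l; have [_ /(_ b hr)] := Ical_approx k l bD.
  apply: cvg_eventually; exists 0%N => s _.
  by rewrite /J -(eval_lift_hypergeom b b (ltn0Sn s)) /G /ev -map_mxM [RHS]mxE.
have hdP : mx_cvg abs dP dI.
  move=> k l; have := approx_partial_cvg habs abs_nondiscrete habs_complete r0
    (Ical_approx k l bD) (hdI k l).
  by apply: cvg_eventually; exists 0%N => s _;
    rewrite /dP /ev [RHS]mxE [map_mx (mderiv i) _ _ _]mxE.
pose W s := dP s - H *m (J s *m G s).
have hW : mx_cvg abs W v.
  by apply: (mx_cvgB habs hdP); apply: (mx_cvgM habs) hP; apply: (mx_cvg_cst habs).
(* Since [G s] inverts [A s] at [b], the term [J s *m dG s] is [J s *m G s *m X s]. *)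
pose X s := A s *m dG s.
have hdPE s : dP s = (H *m J s + (p ^ s.+1)%:R *: E s) *m G s + J s *m dG s.
  rewrite /dP /lift_Ical.
  have -> : map_mx (mderiv i) (lift_hypergeom b s.+1 *m lift_inverse b s.+1) =
     map_mx (mderiv i) (lift_hypergeom b s.+1) *m lift_inverse b s.+1 +
     lift_hypergeom b s.+1 *m map_mx (mderiv i) (lift_inverse b s.+1).
    apply/matrixP => k l; rewrite !mxE (raddf_sum (mderiv i)) -big_split.
    by apply: eq_bigr => j _; rewrite /= mderivM !mxE.
  rewrite /ev map_mxD !map_mxM mderiv_lift_hypergeom eval_lift_hypergeom //.
  by rewrite (KZ_hypergeom g_gt0 hp hpg natS_neq0 i (ltn0Sn s) bO).
have hGA s : G s *m A s = 1%:M by apply: lift_inverse_center.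
have hWE s : W s = (p ^ s.+1)%:R *: (E s *m G s) + J s *m G s *m X s.
  rewrite /W hdPE mulmxDl -scalemxAl !mulmxA addrAC [_ + _ *: _]addrC addrK.
  by rewrite -(mulmxA (J s)) hGA mulmx1.
have hVJ s : V *m J s *m G s = T + (p ^ s.+1)%:R *: (E' s *m G s).
  have hAG : A s *m G s = 1%:M by apply: mulmx1C.
  rewrite (vandermonde_hypergeom g_gt0 hp hpg natS_neq0) // mulmxDl -mulmxA hAG mulmx1.
  by rewrite -scalemxAl.
(* The defect of [W s] under the approximate projector, divided by [p ^ s.+1]: the main part [J G X]
   cancels because [V J G] is [T] up to that factor, leaving products of bounded matrices. *)
pose Z s := E s *m G s - J s *m G s *m invmx T *m V *m (E s *m G s)
   - J s *m G s *m invmx T *m (E' s *m G s) *m X s.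
have hZ s : W s - J s *m G s *m (invmx T *m V *m W s) = (p ^ s.+1)%:R *: Z s.
  have -> : J s *m G s *m (invmx T *m V *m W s) =
     (p ^ s.+1)%:R *: (J s *m G s *m invmx T *m V *m (E s *m G s)) +
     J s *m G s *m invmx T *m (V *m J s *m G s) *m X s.
    by rewrite hWE !mulmxDr -!scalemxAr !mulmxA.
  rewrite hVJ mulmxDr mulmxKV // mulmxDl -scalemxAr -scalemxAl hWE /Z !scalerBr.
  set a := _ *: _; set c := J s *m _ *m _; set d := _ *: _; set f := _ *: _.
  by rewrite (addrCA d) [a + c]addrC opprD addrACA subrr add0r opprD addrA.
have ub_le1 m1 m2 (M : nat -> 'M[K]_(m1, m2)) :
    (forall s, mx_bounded abs 1 (M s)) -> mx_ubounded M by exists 1.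
have uJ : mx_ubounded J.
  by apply: ub_le1 => s k l; apply: (hypergeom_le1 g_gt0 habs hp hpg).
have uA : mx_ubounded A by apply: ub_le1 => s k l; apply: hasse_witt_le1.
have uE : mx_ubounded E.
  by apply: ub_le1 => s; apply: (KZ_error_le1 g_gt0 habs hp hpg abs_nat_coprime).
have uE' : mx_ubounded E'.
  apply: ub_le1 => s k l; rewrite mxE.
  have hS := abs_le1_subring habs; have [_ hB _] := hS.
  apply: (subring_predM hS); last by apply: hasse_witt_le1.
  apply: (subring_predM hS); last by apply: hB; apply: (subring_pred_nat hS).
  by rewrite /abs_le1 absV // (abs_half_pow g_gt0 hp hpg abs_nat_coprime) // invr1.
have gG s := gauss_le_lift_inverse bD (ltn0Sn s) r0 r1.
have hoff k : abs (offset b b k) <= 2%:R^-1 by apply: hr.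
have uG : mx_ubounded G.
  apply: ub_le1 => s k l; rewrite mxE.
  exact: (gauss_le_eval habs (ltW r0) (gG s k l) hoff).
have udG : mx_ubounded dG.
  (* A Gauss norm at most 1 at radius 1/2 bounds the derivative by 2. *)
  exists (1 / 2%:R^-1) => [|s k l]; first by rewrite divr_ge0 // ltW.
  rewrite 2!mxE; apply: (gauss_le_eval habs (ltW r0) _ hoff).
  exact: (gauss_le_deriv habs i r0 (gG s k l)).
have [c c0 hc] : mx_ubounded Z.
  have uJG := mx_uboundedM uJ uG; have uEG := mx_uboundedM uE uG.
  have uX := mx_uboundedM uA udG; have uE'G := mx_uboundedM uE' uG.
  have uJGT := mx_uboundedM uJG (mx_ubounded_cst (invmx T)).
  apply: mx_uboundedB; last exact: (mx_uboundedM (mx_uboundedM uJGT uE'G) uX).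
  apply: mx_uboundedB => //.
  exact: (mx_uboundedM (mx_uboundedM uJGT (mx_ubounded_cst V)) uEG).
have h0 : mx_cvg abs (fun s => W s - J s *m G s *m (invmx T *m V *m W s)) 0.
  have hcv : mx_cvg abs (fun s => (p ^ s.+1)%:R *: Z s) 0.
    by apply: (mx_cvg0_scale habs abs_p_cvg0 (c := c)); exists 0%N => s _.
  by move=> k l; apply: cvg_eventually (hcv k l); exists 0%N => s _; rewrite hZ.
have h1 : mx_cvg abs (fun s => W s - J s *m G s *m (invmx T *m V *m W s))
    (v - Ical b *m (invmx T *m V *m v)).
  apply: (mx_cvgB habs hW); apply: (mx_cvgM habs hP).
  by apply: (mx_cvgM habs) hW; apply: (mx_cvg_cst habs).
by apply/eqP; rewrite -subr_eq0 (mx_cvg_unique habs h1 h0).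
Qed.

End HypergeometricDistribution.

(** * Invariance of the distribution *)

Lemma map_power_sum_mx (S S' : comNzRingType) (f : {rmorphism S -> S'}) g n (x : 'I_n -> S) :
  map_mx f (power_sum_mx g x) = power_sum_mx g (f \o x).
Proof.
apply/matrixP => k a; rewrite !mxE rmorphB !rmorphMn rmorph1 rmorph_sum.
congr (_ - _ *+ _); apply: eq_bigr => j _; exact: rmorphXn.
Qed.

Lemma sum_scale_col (K : fieldType) m1 m2 (A : 'M[K]_(m1, m2)) (c : 'I_m2 -> K) :
  \sum_j c j *: col j A = A *m \col_j c j.
Proof.
apply/colP => k; rewrite summxE mxE; apply: eq_bigr => j _.
by rewrite !mxE mulrC.
Qed.

(** * Analyticity of the connection matrices *)

Section AnalyticMatrices.
Variables (R : realType) (K : fieldType) (abs : K -> R).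
Hypothesis habs : nonarch_abs abs.
Hypothesis abs_nondiscrete : forall e : R, 0 < e -> exists2 h : K, h != 0 & abs h < e.
Hypothesis habs_complete : abs_complete abs.
Hypothesis natS_neq0 : forall k, k.+1%:R != 0 :> K.

Definition mx_analytic_at n m1 m2 (A : 'rV[K]_n -> 'M[K]_(m1, m2)) b : Prop :=
  forall i j, analytic_at abs (fun z => A z i j) b.

Section Closure.
Variables (n : nat) (b : 'rV[K]_n).

Lemma mx_analytic_atM m1 m2 m3 (A : 'rV[K]_n -> 'M[K]_(m1, m2)) (B : 'rV[K]_n -> 'M[K]_(m2,
  m3)) :
  mx_analytic_at A b -> mx_analytic_at B b -> mx_analytic_at (fun z => A z *m B z) b.
Proof.
move=> hA hB i j.
have h : analytic_at abs (fun z => \sum_k A z i k * B z k j) b.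
  by apply: analytic_at_sum => // k _; apply: analytic_atM.
by apply: (analytic_at_ext habs ltr01 _ h) => z _; rewrite mxE.
Qed.

Lemma mx_analytic_atB m1 m2 (A B : 'rV[K]_n -> 'M[K]_(m1, m2)) :
  mx_analytic_at A b -> mx_analytic_at B b -> mx_analytic_at (fun z => A z - B z) b.
Proof.
move=> hA hB i j.
have hN : analytic_at abs (fun z => -1 * B z i j) b.
  by apply: analytic_atM => //; apply: analytic_at_cst.
have h : analytic_at abs (fun z => A z i j + -1 * B z i j) b by apply: analytic_atD.
by apply: (analytic_at_ext habs ltr01 _ h) => z _; rewrite !mxE mulN1r.
Qed.

End Closure.

Section Connection.
Variables p g : nat.
Local Notation n := (2 * g + 1)%N.
Hypotheses (g_gt0 : (0 < g)%N) (hp : prime p) (hpg : (2 * g + 1 < p)%N).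
Implicit Types (b z : 'rV[K]_n).

Lemma vandermonde_analytic b : mx_analytic_at (fun z => vandermonde g (coords z)) b.
Proof.
move=> k j.
have h := analytic_at_poly habs abs_nondiscrete habs_complete natS_neq0
  (lift_coords b j ^+ k.+1) b.
apply: (analytic_at_ext habs ltr01 _ h) => z _.
by rewrite mxE rmorphXn /= mevalD mevalXU mevalC /offset subrK.
Qed.

(** The determinant is a nonzero constant, so the inverse is a constant multiple of the adjugate, a
    polynomial in [z]. *)
Lemma inv_power_sum_mx_analytic b :
  mx_analytic_at (fun z => invmx (power_sum_mx g (coords z))) b.
Proof.
move=> j k; pose c : K := \prod_(k < g) ((2 * k.+1)%:R - n%:R).
have h := analytic_at_poly habs abs_nondiscrete habs_complete natS_neq0
  (\adj (power_sum_mx g (lift_coords b)) j k) b.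
have hc : analytic_at abs (fun=> c^-1) b by apply: analytic_at_cst.
have hM := analytic_atM habs abs_nondiscrete habs_complete natS_neq0 hc h.
apply: (analytic_at_ext habs ltr01 _ hM) => z _.
rewrite /invmx (power_sum_mx_unit g_gt0 hp hpg natS_neq0) det_power_sum_mx [RHS]mxE.
congr (_ * _).
have -> : power_sum_mx g (coords z) =
    map_mx (meval (offset b z)) (power_sum_mx g (lift_coords b)).
  rewrite map_power_sum_mx; apply/matrixP => k' a; rewrite !mxE; congr (_ - _ *+ _).
  by apply: eq_bigr => i _; rewrite /= mevalD mevalXU mevalC /offset subrK.
by rewrite -map_mx_adj [RHS]mxE.
Qed.

Lemma KZ_H_analytic i b : off_diagonals b -> mx_analytic_at (fun z => KZ_H i z) b.
Proof.
move=> hb k l.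
have h : analytic_at abs (fun z => \sum_(j < n | j != i)
    (z 0 i - z 0 j)^-1 * (2%:R^-1 * Omega K i j k l)) b.
  apply: analytic_at_sum => // j ji; apply: analytic_atM => //; last exact: analytic_at_cst.
  by apply: analytic_at_invB => //; apply: hb; rewrite eq_sym.
apply: (analytic_at_ext habs ltr01 _ h) => z _.
rewrite mxE summxE mulr_sumr; apply: eq_bigr => j _.
by rewrite mulrCA; congr (_ * _); rewrite [RHS]mxE.
Qed.

End Connection.

End AnalyticMatrices.

Theorem theorem6p7 (R : realType) (g p m : nat)
  (hg : (1 <= g)%N) (hp : prime p) (hpg : (2 * g + 1 < p)%N)
  (Qp : fieldType) (absQp : Qp -> R) (hQp : is_Qp p absQp)
  (K : fieldExtType Qp) (abs : K -> R)
  (hK : is_unramified_ext absQp m abs)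
  (hm : ((p - 1) %/ 2 * g ^ 2 < p ^ m)%N)
  (Ical : 'rV[K]_(2 * g + 1) -> 'M[K]_(2 * g + 1, g))
  (hI : is_limit_matrix abs p Ical)
  (U : set 'rV[K]_(2 * g + 1))
  (hUo : open_set abs U) (hUD : U `<=` @D_KZ R K abs p g)
  (f : 'rV[K]_(2 * g + 1) -> 'cV[K]_(2 * g + 1))
  (hf : is_section abs Ical U f) (i : 'I_(2 * g + 1)) :
  exists2 nf : 'rV[K]_(2 * g + 1) -> 'cV[K]_(2 * g + 1),
    forall z, (U `&` @off_diagonals K g) z -> is_nabla_KZ abs i f z (nf z) &
    is_section abs Ical (U `&` @off_diagonals K g) nf.
Proof.
have [_ habs _ _] := hK.
have hp1 : abs p%:R < 1 := abs_prime_lt1 hp hQp hK.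
have hnat := abs_coprime hp hQp hK.
have hchar := ext_natS_neq0 hp hQp hK.
have hnd := ext_nondiscrete hp hQp hK.
have hcomp := unramified_complete hQp hK.
have [c hc hfE] := hf.
have hIa k l : analytic_on abs (fun z => Ical z k l) U.
  by move=> b /hUD; apply: (Ical_analytic hg habs hp hpg hp1 hchar hnd hcomp hI).
have hpartial h : analytic_on abs h U -> exists d, analytic_on abs d U /\
    forall z, U z -> is_partial abs i h z (d z).
  move=> hh; have [d hd hd'] := analytic_on_partial habs hnd hcomp hchar i hUo hh.
  by exists d.
have [dc dcP] := choice (fun j => hpartial _ (hc j)).
have [dI' dIP] := choice (fun kl => hpartial _ (hIa kl.1 kl.2)).
pose dI z : 'M[K]_(2 * g + 1, g) := \matrix_(k, l) dI' (k, l) z.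
pose M z := invmx (power_sum_mx g (coords z)) *m vandermonde g (coords z) *m
  (dI z - KZ_H i z *m Ical z).
(* Leibniz rule: [nabla (Ical c) = Ical (dc) + (nabla Ical) c = Ical (dc + M c)], where
   [nabla Ical = Ical M] by [nabla_Ical_in_span]. *)
pose c' j z := dc j z + \sum_k M z j k * c k z.
exists (fun z => \sum_j c' j z *: col j (Ical z)) => [z [Uz zO] | ]; last first.
  exists c' => // j b [Ub bO].
  have hM : mx_analytic_at abs M b.
    apply: mx_analytic_atM => //.
      apply: mx_analytic_atM => //; first exact: (inv_power_sum_mx_analytic _ _ _ _ hg hp hpg).
      exact: vandermonde_analytic.
    apply: mx_analytic_atB => // [k l|].
      have := (dIP (k, l)).1 b Ub; apply: analytic_at_ext ltr01 _ => // z _.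
      by rewrite mxE.
    by apply: mx_analytic_atM => //; [apply: KZ_H_analytic | move=> k l; apply: hIa].
  apply: analytic_atD => //; first exact: (dcP j).1.
  apply: analytic_at_sum => // k _; apply: analytic_atM => //; exact: hc.
have zD := hUD z Uz.
have [r r0 hr] := open_polydisc hUo Uz.
pose df : 'cV[K]_(2 * g + 1) :=
  \col_k \sum_j (dc j z * Ical z k j + c j z * dI z k j).
exists df => [k|].
  rewrite mxE.
  have h : is_partial abs i (fun y => \sum_j c j y * Ical y k j) z
      (\sum_j (dc j z * Ical z k j + c j z * dI z k j)).
    apply: is_partial_sum => // j; apply: is_partialM => //; first exact: hc.
    - exact: hIa.
    - exact: (dcP j).2.
    by rewrite mxE; apply: (dIP (k, j)).2.
  apply: (is_partial_ext habs r0 _ h) => y hy; rewrite hfE; last exact: hr.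
  by rewrite summxE; apply: eq_bigr => j _; rewrite !mxE.
have hv : dI z - KZ_H i z *m Ical z = Ical z *m M z.
  apply: (nabla_Ical_in_span hg habs hp hpg hp1 hnat hchar hnd hcomp hI zD zO) => k l.
  by rewrite mxE; apply: (dIP (k, l)).2.
rewrite hfE // !sum_scale_col.
have -> : df = Ical z *m (\col_j dc j z) + dI z *m (\col_j c j z).
  apply/colP => k; rewrite !mxE -big_split; apply: eq_bigr => j _ /=.
  by rewrite !mxE; ring.
rewrite -addrA mulmxA -mulmxBl hv -mulmxA -mulmxDr; congr (_ *m _).
apply/colP => j; rewrite [LHS]mxE [RHS]mxE [X in _ = X + _]mxE [X in _ = _ + X]mxE.
by congr (_ + _); apply: eq_bigr => k _; congr (_ * _); rewrite mxE.
Qed.
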